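(* Write $n=N^\kappa$ with $0<\kappa<1/2$, and assume that $\lambda_0$ and $\lambda_1$ are both fixed. No test is asymptotically powerful in each of the following situations: (1) $\lambda_1<1$ and $\lambda_1^2e\le\lambda_0$; (2) $\lambda_1<1$, $\lambda_1^2e>\lambda_0$, and $\displaystyle\frac{1-2\kappa}{\kappa}\,\frac{I_{\lambda_1}}{\log\left(\frac{e\lambda_1^2}{\lambda_0}\right)}>1$.
   Context: Setting. We observe an undirected simple graph $\mathcal{G}$ on the node set $\mathcal{V}=\{1,\dots,N\}$ with adjacency matrix $(W_{i,j})$ (symmetric, $0/1$, zero diagonal). Under the null hypothesis, with distribution $\mathbb{P}_0$, $\mathcal{G}$ is an Erdős–Rényi graph $\mathbb{G}(N,p_0)$, i.e. the $W_{i,j}$, $i<j$, are i.i.d. Bernoulli($p_0$). For $S\subset\mathcal{V}$ with $|S|=n$, under $\mathbb{P}_S$ the $W_{i,j}$, $i<j$, are independent with $\mathbb{P}_S(W_{i,j}=1)=p_1$ if $i,j\in S$ and $=p_0$ otherwise, where $p_1>p_0$. The alternative is the union over all $S$ with $|S|=n$. The parameters $n,p_0,p_1$ depend on $N$; all limits are as $N\to\infty$. Notation. $\lambda_0=Np_0$, $\lambda_1=np_1$, and $I_\lambda=\lambda-1-\log\lambda$ for $\lambda>0$. ($n=N^\kappa$ is understood up to rounding to an integer.) Tests. A test $\phi$ is a $\{0,1\}$-valued function of the adjacency matrix; its risk is $\gamma_N(\phi)=\mathbb{P}_0(\phi=1)+\max_{|S|=n}\mathbb{P}_S(\phi=0)$.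 A sequence of tests $(\phi_N)$ is asymptotically powerful if $\gamma_N(\phi_N)\to0$; ''no test is asymptotically powerful'' means $\liminf\gamma_N^*>0$, where $\gamma_N^*=\inf_\phi\gamma_N(\phi)$ over all tests. *)

(* Defs.v *)
From HB Require Import structures.
From mathcomp Require Import all_boot all_order all_algebra.
From mathcomp Require Import all_classical all_reals all_analysis.

Set Implicit Arguments.
Unset Strict Implicit.
Unset Printing Implicit Defensive.

Import Order.TTheory GRing.Theory Num.Theory.

Local Open Scope ring_scope.

(* Simple graphs on the nodes 'I_N, as adjacency matrices. *)
Definition is_adjacency (N : nat) (W : 'M[bool]_N) : bool :=
  [forall i, forall j, W i j == W j i] && [forall i, ~~ W i i].

Definition graph (N : nat) : finType := {W : 'M[bool]_N | is_adjacency W}.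

(* Law of a random graph whose edge indicators W i j, i < j, are independent,
   W i j being Bernoulli(q i j); only the values q i j with i < j matter. *)
Definition graph_pmf (R : realType) (N : nat) (q : 'I_N -> 'I_N -> R)
    (W : graph N) : R :=
  \prod_(i < N) \prod_(j < N | (i < j)%N) bernoulli_pmf (q i j) (val W i j).

Definition graph_prob (R : realType) (N : nat) (q : 'I_N -> 'I_N -> R)
    (A : pred (graph N)) : R :=
  \sum_(W : graph N | A W) graph_pmf q W.

Definition prob_null (R : realType) (N : nat) (p0 : R) : pred (graph N) -> R :=
  graph_prob (fun _ _ => p0).

Definition prob_planted (R : realType) (N : nat) (p0 p1 : R) (S : {set 'I_N}) :
    pred (graph N) -> R :=
  graph_prob (fun i j => if (i \in S) && (j \in S) then p1 else p0).

Definition test (N : nat) : Type := graph N -> bool.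

(* The maximum is of nonnegative terms as soon as p0 and p1 are in [0, 1], so
   that starting it at 0 is harmless. *)
Definition risk (R : realType) (N n : nat) (p0 p1 : R) (phi : test N) : R :=
  prob_null p0 (fun W => phi W) +
  \big[Num.max/0]_(S : {set 'I_N} | #|S| == n)
     prob_planted p0 p1 S (fun W => ~~ phi W).

Definition minimax_risk (R : realType) (N n : nat) (p0 p1 : R) : R :=
  inf (range (fun phi : test N => risk n p0 p1 phi)).

(* The lower limit is taken in the extended reals, where it always exists. *)
Definition no_test_asymptotically_powerful (R : realType) (n : nat -> nat)
    (p0 p1 : nat -> R) : Prop :=
  (0 < limn_einf (fun N => (minimax_risk N (n N) (p0 N) (p1 N))%:E))%E.

Definition rate (R : realType) (lambda : R) : R := lambda - 1 - ln lambda.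

(* Main.v *)
(** The worst-case risk is at least the total mass of the minimum of P_0 and of
    the average over S of P_S restricted to a truncation event Gamma_S. It is
    therefore bounded below as soon as the P_S(Gamma_S) are bounded below and the
    second moment of the truncated likelihood ratio is bounded above.

    Gamma_S requires the graph induced on S to be a forest with trees of at most
    k ~ c log N vertices. The second moment is then at most the sum, over such
    forests H on S, of (p1^2/p0)^(number of edges of H) times the probability,
    at most (n/N)^(number of non-isolated vertices of H), that a random S'
    contains the edges of H; a tree with j vertices contributes about
    (n^2/N) (e lambda1^2/lambda0)^j, which is harmless for j <= k when
    c log(e lambda1^2/lambda0) < 1 - 2 kappa. Conversely, for lambda1 < 1 the
    graph induced on S is a forest with probability bounded below, and it has no
    component of more than c log N vertices, with high probability, when
    c I_{lambda1} > kappa.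

    Both estimates are obtained by exploring the graph on S vertex by vertex. *)
Require Import Defs.
From mathcomp Require Import all_boot all_order all_algebra.
From mathcomp Require Import zify ring lra.
From mathcomp Require Import reals sequences exp.

Set Implicit Arguments.
Unset Strict Implicit.
Unset Printing Implicit Defensive.

Import Order.TTheory GRing.Theory Num.Theory.
Local Open Scope ring_scope.

(** * Exploration of small forests *)

(** Edges are unordered two-element vertex sets, so a simple graph on [A] is just a subset of
    [pairs A]. *)
Definition pairs (T : finType) (A : {set T}) : {set {set T}} :=
  [set e : {set T} | (e \subset A) && (#|e| == 2)].

Definition star (T : finType) (v : T) (D : {set T}) : {set {set T}} :=
  [set [set v; u] | u in D].

Lemma pairs_sub (T : finType) (A B : {set T}) :
  A \subset B -> pairs A \subset pairs B.
Proof.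
move=> AB; apply/subsetP=> e; rewrite !inE => /andP[eA ->].
by rewrite (subset_trans eA AB).
Qed.

Lemma pairsI (T : finType) (A B : {set T}) :
  pairs (A :&: B) = pairs A :&: pairs B.
Proof.
by apply/setP=> e; rewrite !inE subsetI; case: (_ \subset A) (_ \subset B) (_ == _) => [] [] [].
Qed.

Lemma pairs0 (T : finType) : pairs (@set0 T) = set0.
Proof.
apply/setP=> e; rewrite !inE subset0; apply/negP=> /andP[/eqP->].
by rewrite cards0.
Qed.

Lemma pairsP (T : finType) (A e : {set T}) :
  reflect (exists u v, [/\ u \in A, v \in A, u != v & e = [set u; v]])
          (e \in pairs A).
Proof.
apply: (iffP idP) => [|[u [v [uA vA uv ->]]]].
  rewrite inE => /andP[/subsetP eA /cards2P[u [v [uv ee]]]].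
  by exists u, v; split; rewrite // eA // ee !inE eqxx ?orbT.
by rewrite inE cards2 uv eqxx subUset !sub1set uA vA.
Qed.

Lemma pairs_star (T : finType) (v : T) (A e : {set T}) :
  e \in pairs A -> v \in e -> exists u, [/\ u \in A :\ v & e = [set v; u]].
Proof.
case/pairsP=> x [y [xA yA xy ->]]; rewrite !inE => /orP[]/eqP->.
  by exists y; rewrite !inE eq_sym xy.
by exists x; rewrite !inE xy setUC.
Qed.

Lemma mem_star (T : finType) (v u : T) (D : {set T}) :
  v != u -> v \notin D -> ([set v; u] \in star v D) = (u \in D).
Proof.
move=> vu vD; apply/imsetP/idP => [[w wD /setP/(_ u)]|uD]; last by exists u.
by rewrite !inE eqxx orbT eq_sym (negPf vu) => /esym/eqP->.
Qed.

Lemma set2_inj (T : finType) (v : T) (D : {set T}) :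
  v \notin D -> {in D &, injective (fun u => [set v; u])}.
Proof.
move=> vD x y xD yD /setP/(_ x); rewrite !inE eqxx orbT.
have /negPf-> : x != v by apply: contraNneq vD => <-.
by move=> /esym/eqP.
Qed.

Lemma card_star (T : finType) (v : T) (D : {set T}) :
  v \notin D -> #|star v D| = #|D|.
Proof. by move=> vD; rewrite card_in_imset //; apply: set2_inj. Qed.

Lemma star_sub_pairs (T : finType) (v : T) (A D : {set T}) :
  v \in A -> D \subset A :\ v -> star v D \subset pairs A.
Proof.
move=> vA /subsetP DA; apply/subsetP=> e /imsetP[u uD ->].
move: (DA _ uD); rewrite !inE => /andP[uv uA].
by apply/andP; rewrite cards2 (eq_sym v) uv subUset !sub1set vA uA.
Qed.

Lemma disjoint_star (T : finType) (v : T) (A D : {set T}) (H : {set {set T}}) :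
  H \subset pairs (A :\ v) -> [disjoint H & star v D].
Proof.
move=> /subsetP HA; apply/pred0P=> e /=; apply/negP=> /andP[/HA].
rewrite inE => /andP[/subsetP eA _] /imsetP[u _ ee].
by have := eA v; rewrite ee !inE !eqxx => /(_ isT).
Qed.

(** A graph on [A] amounts to the neighbourhood [D] of [v] together with the graph left on [A :\ v];
    [h] and [h'] are the two directions of this bijection. *)
Lemma big_pairs_peel (R : Type) (idx : R) (op : Monoid.com_law idx)
    (T : finType) (v : T) (A : {set T}) (F : {set {set T}} -> R) :
  v \in A ->
  \big[op/idx]_(H : {set {set T}} | H \subset pairs A) F H =
  \big[op/idx]_(D : {set T} | D \subset A :\ v)
    \big[op/idx]_(H : {set {set T}} | H \subset pairs (A :\ v))
       F (H :|: star v D).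
Proof.
move=> vA; rewrite pair_big_dep /=.
pose h (p : {set T} * {set {set T}}) := p.2 :|: star v p.1.
pose h' (H : {set {set T}}) :=
  ([set u | [set v; u] \in H & u != v], H ::&: (A :\ v)).
rewrite (reindex_onto h h') => [|H HA]; last first.
  apply/setP=> e; rewrite !inE; apply/orP/idP.
    case=> [/andP[]//|/imsetP[u]]; by rewrite inE => /andP[uH _ ->].
  move=> eH; have eA := subsetP HA _ eH.
  have [ve|ve] := boolP (v \in e); [right|left].
    have [u [uA ee]] := pairs_star eA ve; apply/imsetP; exists u => //.
    by move: uA; rewrite !inE -ee eH => /andP[->].
  by rewrite eH subsetD1 ve andbT; move: eA; rewrite inE => /andP[->].
apply: eq_bigl => -[D H] /=; apply/andP/andP.
  rewrite /h /h' /= => -[HA /eqP[DE HE]]; split.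
    apply/subsetP=> u; rewrite -DE [in X in X -> _]inE => /andP[uH uv].
    move: (subsetP HA _ uH); rewrite !inE uv subUset !sub1set.
    by move=> /andP[/andP[_ ->]].
  apply/subsetP=> e; rewrite -{1}HE inE => /andP[/(subsetP HA)].
  by rewrite !inE => /andP[_ ->] ->.
move=> [DA HA]; split.
  rewrite subUset star_sub_pairs // andbT (subset_trans HA) //.
  by rewrite pairs_sub // subD1set.
have vD : v \notin D by apply/negP=> /(subsetP DA); rewrite !inE eqxx.
apply/eqP; congr (_, _); apply/setP => x; rewrite !inE.
  have [->|xv] := eqVneq x v; first by rewrite andbF (negPf vD).
  rewrite andbT mem_star // 1?eq_sym //; case: (_ \in H) / boolP => //.
  move/(subsetP HA); rewrite inE subUset !sub1set !inE eqxx //.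
apply/andP/idP => [[/orP[//|]]|xH].
  by move=> /imsetP[u _ ->]; rewrite subUset !sub1set !inE eqxx.
by have := subsetP HA _ xH; rewrite inE xH => /andP[->].
Qed.

(* H is a forest on A whose trees have at most k vertices. Counting edges inside
   vertex sets makes this visibly hereditary: in a forest, the sets B spanning
   #|B| - 1 edges are exactly those inducing a tree. *)
Definition good (T : finType) (k : nat) (A : {set T}) (H : {set {set T}}) :=
  [forall B : {set T}, (B \subset A) ==> (B != set0) ==>
     (#|H ::&: B| + 1 + (k < #|B|) <= #|B|)%N].

(* A state of the exploration of a graph satisfying good k: A holds the vertices
   not yet processed, U the discovered vertices of the tree being explored and m
   is k minus the number of processed vertices X of that tree. The second
   condition is the one of good k for X :|: B, whose number of edges is
   #|X| - 1 + #|B :&: U| plus the number of edges inside B. *)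
Definition tight (T : finType) (k m : nat) (A U : {set T})
    (H : {set {set T}}) :=
  good k A H && [forall B : {set T}, (B \subset A) ==>
     (#|H ::&: B| + #|B :&: U| + (m < #|B|) <= #|B|)%N].

Lemma goodP (T : finType) (k : nat) (A : {set T}) (H : {set {set T}}) :
  reflect (forall B : {set T}, B \subset A -> B != set0 ->
             (#|H ::&: B| + 1 + (k < #|B|) <= #|B|)%N)
          (good k A H).
Proof.
apply: (iffP forallP) => h B; last by apply/implyP=> ?; apply/implyP; apply: h.
by move=> BA B0; have := h B; rewrite BA B0.
Qed.

Lemma tightP (T : finType) (k m : nat) (A U : {set T}) (H : {set {set T}}) :
  reflect (good k A H /\ forall B : {set T}, B \subset A ->
             (#|H ::&: B| + #|B :&: U| + (m < #|B|) <= #|B|)%N)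
          (tight k m A U H).
Proof.
apply: (iffP andP) => -[gA h]; split=> //; last first.
  by apply/forallP=> B; apply/implyP; apply: h.
by move=> B BA; have /forallP/(_ B) := h; rewrite BA.
Qed.

Lemma goodS (T : finType) (k : nat) (A A' : {set T}) (H H' : {set {set T}}) :
  A' \subset A -> H' \subset H -> good k A H -> good k A' H'.
Proof.
move=> AA HH /goodP g; apply/goodP=> B BA B0.
have := g B (subset_trans BA AA) B0; apply: leq_trans.
rewrite !leq_add2r; apply/subset_leq_card/subsetP=> e.
by rewrite !inE => /andP[/(subsetP HH) -> ->].
Qed.

Lemma ssetI_star_out (T : finType) (v : T) (B D : {set T}) (H : {set {set T}}) :
  v \notin B -> (H :|: star v D) ::&: B = H ::&: B.
Proof.
move=> vB; apply/setP=> e; rewrite !inE; case: (_ \in H) => //=.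
apply/negP=> /andP[/imsetP[u _ ->]].
by rewrite subUset !sub1set (negPf vB).
Qed.

(** The edges inside [B] either avoid [v] or join [v] to a point of [D] in [B], and these two
    families are disjoint. *)
Lemma card_ssetI_star (T : finType) (v : T) (A B D : {set T})
    (H : {set {set T}}) :
  v \in B -> H \subset pairs (A :\ v) -> v \notin D ->
  #|(H :|: star v D) ::&: B| = (#|H ::&: (B :\ v)| + #|(B :\ v) :&: D|)%N.
Proof.
move=> vB HA vD; have vBD : v \notin (B :\ v) :&: D by rewrite !inE eqxx.
have -> : (H :|: star v D) ::&: B = (H ::&: (B :\ v)) :|: star v ((B :\ v) :&: D).
  apply/setP=> e; rewrite !inE; apply/andP/orP.
    case=> [/orP[eH|/imsetP[u uD ->]]].
      rewrite eH subsetD1 => ->; left; apply/negP=> ve.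
      by have := subsetP HA _ eH; rewrite inE subsetD1 ve andbF.
    rewrite subUset !sub1set => /andP[_ uB]; right; apply/imsetP; exists u => //.
    by rewrite !inE uB uD (contraNneq _ vD) // => <-.
  case=> [/andP[-> ]|/imsetP[u]].
    by rewrite subsetD1 => /andP[].
  rewrite !inE => /andP[/andP[_ uB] uD] ->; split; last by rewrite subUset !sub1set vB.
  by apply/orP; right; apply/imsetP; exists u.
rewrite cardsU -(card_star vBD) -[RHS]subn0; congr (_ - _)%N; apply/eqP.
rewrite cards_eq0 setI_eq0.
apply: disjoint_star; apply: subset_trans HA.
by apply/subsetP=> e; rewrite inE => /andP[].
Qed.

(* Processing v reveals its set D of neighbours among the unprocessed vertices. *)
Lemma tight_peel (T : finType) (k m : nat) (v : T) (A U D : {set T})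
    (H : {set {set T}}) :
  (m <= k)%N -> v \in U -> U \subset A -> D \subset A :\ v ->
  H \subset pairs (A :\ v) ->
  tight k m A U (H :|: star v D) =
  [&& [disjoint D & U], (0 < m)%N
    & tight k m.-1 (A :\ v) ((U :\ v) :|: D) H].
Proof.
move=> mk vU UA DA HA; have vA := subsetP UA _ vU.
have vD : v \notin D by apply/negP=> /(subsetP DA); rewrite !inE eqxx.
apply/tightP/and3P => [[g t]|[DU m0 /tightP[/goodP g t]]].
  have m0 : (0 < m)%N.
    have := t [set v]; rewrite sub1set vA cards1 => /(_ isT).
    have -> : [set v] :&: U = [set v] by apply/setIidPl; rewrite sub1set.
    by rewrite cards1; lia.
  split=> //.
    (* A neighbour [u] of [v] already in [U] would close a cycle: the set of [v] and [u] has one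
       edge and two points in [U], but only two elements. *)
    apply/pred0P=> u /=; apply/negP=> /andP[uD uU].
    have uA := subsetP UA _ uU.
    have vu : v != u by apply: contraNneq vD => ->.
    have := t [set v; u]; rewrite subUset !sub1set vA uA cards2 vu => /(_ isT).
    have -> : [set v; u] :&: U = [set v; u].
      by apply/setIidPl; rewrite subUset !sub1set vU.
    rewrite cards2 vu.
    suff : (0 < #|(H :|: star v D) ::&: [set v; u]|)%N.
      by move: #|_ ::&: _| => e; clear; lia.
    apply/card_gt0P; exists [set v; u]; rewrite !inE subxx andbT.
    by rewrite mem_star // uD orbT.
  apply/tightP; split.
    by apply: goodS g; rewrite ?subD1set // subsetUl.
  move=> B BA; have vB : v \notin B.
    by apply/negP=> /(subsetP BA); rewrite !inE eqxx.
  (* The new constraint on [B] is the old one on [v |: B]: adding [v] raises the size and the count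
     in [U] by one each, and adds [#|B :&: D|] edges. *)
  have BvA : v |: B \subset A.
    by rewrite subUset sub1set vA (subset_trans BA) // subD1set.
  have := t _ BvA; rewrite (card_ssetI_star _ HA) ?setU11 // setU1K //.
  rewrite cardsU1 vB /= (_ : #|(v |: B) :&: U| = (1 + #|B :&: (U :\ v)|)%N); last first.
    rewrite (cardsD1 v) !inE eqxx vU /=; congr (_ + #|pred_of_set _|)%N.
    apply/setP=> x; rewrite !inE; have [->|] //= := eqVneq x v.
    by rewrite andbF.
  have : (#|B :&: (U :\ v :|: D)| <= #|B :&: (U :\ v)| + #|B :&: D|)%N.
    by rewrite setIUr cardsU leq_subr.
  case: (m) m0 => // m' _ /=; rewrite add1n ltnS.
  by move: #|_ ::&: _| #|_| #|_| #|_| (_ < _)%N; clear; lia.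
have setI_out (B : {set T}) : v \notin B -> B :&: U = B :&: (U :\ v).
  move=> vB; apply/setP=> x; rewrite !inE; have [->|//] := eqVneq x v.
  by rewrite (negPf vB).
have caseA (B : {set T}) : B \subset A -> v \notin B -> B \subset A :\ v.
  by move=> BA vB; rewrite subsetD1 BA vB.
have tB (B : {set T}) : B \subset A ->
   (#|(H :|: star v D) ::&: B| + #|B :&: U| + (m < #|B|) <= #|B|)%N.
  move=> BA; have [vB|vB] := boolP (v \in B).
    rewrite (card_ssetI_star vB HA vD).
    have := t (B :\ v); rewrite setSD // => /(_ isT).
    rewrite setIUr cardsU.
    rewrite (_ : _ :&: _ :&: _ = set0); last first.
      apply/setP=> x; rewrite !inE; apply/negP=> /andP[/andP[_ /andP[_ xU]]].
      by move=> /andP[_ xD]; move/pred0P: DU => /(_ x) /=; rewrite xU xD.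
    rewrite cards0 subn0 (cardsD1 v (B :&: U)) !inE vB vU /=.
    rewrite (cardsD1 v B) vB.
    rewrite (_ : (B :&: U) :\ v = (B :\ v) :&: (U :\ v)); last first.
      by apply/setP=> x; rewrite !inE; case: (x != v).
    case: (m) m0 => // m' _ /=; rewrite add1n ltnS.
    by move: #|_ ::&: _| #|_| #|_| #|_| (_ < _)%N; clear; lia.
  rewrite ssetI_star_out //.
  apply: leq_trans (t B (caseA _ BA vB)); rewrite (setI_out _ vB).
  apply: leq_add; first by rewrite leq_add2l setIUr subset_leq_card // subsetUl.
  by case: (ltnP m) => // h; rewrite (leq_ltn_trans (leq_pred m) h).
split=> //; apply/goodP=> B BA B0.
have [vB|vB] := boolP (v \in B).
  apply: leq_trans (tB B BA); apply: leq_add.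
    by rewrite leq_add2l; apply/card_gt0P; exists v; rewrite !inE vB.
  by case: (ltnP k) => // h; rewrite (leq_ltn_trans mk h).
by rewrite ssetI_star_out //; apply: g => //; apply: caseA.
Qed.

Lemma ssetI0 (T : finType) (A : {set T}) (H : {set {set T}}) :
  H \subset pairs A -> H ::&: set0 = set0.
Proof.
move=> HA; apply/setP=> e; rewrite !inE subset0; apply/negP=> /andP[/(subsetP HA)].
by rewrite inE => /andP[_ /eqP e2] /eqP e0; rewrite e0 cards0 in e2.
Qed.

(** Starts the exploration of a tree: with a single discovered vertex, [B :&: U] has at most one
    element, which is the [+ 1] in [good]. *)
Lemma tight_root (T : finType) (k : nat) (v : T) (A : {set T})
    (H : {set {set T}}) :
  H \subset pairs A -> tight k k A [set v] H = good k A H.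
Proof.
move=> HA; apply/tightP/idP => [[]//|g]; split=> // B BA.
have [->|B0] := eqVneq B set0; first by rewrite (ssetI0 HA) set0I !cards0.
have := goodP _ _ _ g B BA B0.
have : (#|B :&: [set v]| <= 1)%N.
  by rewrite -(cards1 v) subset_leq_card // subsetIr.
lia.
Qed.

(** Ends the exploration of a tree: with nothing left to process, the [+ 1] in [good] absorbs the
    truth value of [m < #|B|]. *)
Lemma tight0 (T : finType) (k m : nat) (A : {set T}) (H : {set {set T}}) :
  H \subset pairs A -> tight k m A set0 H = good k A H.
Proof.
move=> HA; apply/tightP/idP => [[]//|g]; split=> // B BA; rewrite setI0 cards0.
have [->|B0] := eqVneq B set0; first by rewrite (ssetI0 HA) !cards0.
apply: leq_trans (goodP _ _ _ g B BA B0); rewrite addn0 -addnA leq_add2l.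
by rewrite (leq_trans (leq_b1 _)).
Qed.

Lemma good_peel (T : finType) (k : nat) (v : T) (A D : {set T})
    (H : {set {set T}}) :
  v \in A -> D \subset A :\ v -> H \subset pairs (A :\ v) ->
  good k A (H :|: star v D) = (0 < k)%N && tight k k.-1 (A :\ v) D H.
Proof.
move=> vA DA HA; rewrite -(@tight_root _ _ v); last first.
  rewrite subUset star_sub_pairs // andbT (subset_trans HA) //.
  by rewrite pairs_sub // subD1set.
rewrite tight_peel ?inE // ?sub1set // setDv set0U.
rewrite (_ : [disjoint D & [set v]]) // disjoint_sym disjoints1.
by apply/negP=> /(subsetP DA); rewrite !inE eqxx.
Qed.

(** Taking [B = U] leaves no room for the extra unit incurred when [m < #|U|]. *)
Lemma tight_card (T : finType) (k m : nat) (A U : {set T}) (H : {set {set T}}) :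
  U \subset A -> tight k m A U H -> (#|U| <= m)%N.
Proof.
move=> UA /tightP[_ /(_ U UA)]; rewrite setIid; case: ltnP => //; lia.
Qed.

(** The new neighbours of [v] must avoid [U], since an edge back to [U] closes a cycle; hence [D]
    ranges over the subsets of [A :\: U]. *)
Lemma big_tight_peel (R : Type) (idx : R) (op : Monoid.com_law idx)
    (T : finType) (k m : nat) (v : T) (A U : {set T})
    (F : {set {set T}} -> R) :
  (0 < m <= k)%N -> v \in U -> U \subset A ->
  \big[op/idx]_(H : {set {set T}} | (H \subset pairs A) && tight k m A U H) F H =
  \big[op/idx]_(D : {set T} | D \subset A :\: U)
    \big[op/idx]_(H : {set {set T}} | (H \subset pairs (A :\ v)) &&
        tight k m.-1 (A :\ v) ((U :\ v) :|: D) H)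
       F (H :|: star v D).
Proof.
move=> /andP[m0 mk] vU UA; rewrite big_mkcondr /= (big_pairs_peel _ _ (subsetP UA _ vU)).
have DE (D : {set T}) : (D \subset A :\: U) = (D \subset A :\ v) && [disjoint D & U].
  rewrite subsetD subsetD1; case: (boolP [disjoint _ & _]) => //= DU; rewrite ?andbF // !andbT.
  suff -> : v \notin D by rewrite andbT.
  by apply/negP=> vD; move/pred0P: DU => /(_ v) /=; rewrite vD vU.
rewrite (eq_bigl _ _ DE) big_mkcondr /=.
apply: eq_bigr => D DA; rewrite [in RHS]big_mkcondr /=.
case: ifP => DU; [apply: eq_bigr => H HA|apply: big1 => H HA].
  by rewrite tight_peel // DU m0.
by rewrite tight_peel // DU.
Qed.

Lemma big_good_peel (R : Type) (idx : R) (op : Monoid.com_law idx)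
    (T : finType) (k : nat) (v : T) (A : {set T}) (F : {set {set T}} -> R) :
  (0 < k)%N -> v \in A ->
  \big[op/idx]_(H : {set {set T}} | (H \subset pairs A) && good k A H) F H =
  \big[op/idx]_(D : {set T} | D \subset A :\ v)
    \big[op/idx]_(H : {set {set T}} | (H \subset pairs (A :\ v)) &&
        tight k k.-1 (A :\ v) D H)
       F (H :|: star v D).
Proof.
move=> k0 vA; rewrite big_mkcondr /= (big_pairs_peel _ _ vA).
apply: eq_bigr => D DA; rewrite [in RHS]big_mkcondr /=.
by apply: eq_bigr => H HA; rewrite good_peel // k0.
Qed.

(** * Bernoulli weights of random subsets *)

Lemma prodrD_subset (R : comPzSemiRingType) (I : finType) (E : {set I})
    (F G : I -> R) :
  \prod_(i in E) (F i + G i) =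
  \sum_(J : {set I} | J \subset E) \prod_(i in E) (if i \in J then F i else G i).
Proof.
pose F' i := if i \in E then F i else 0.
pose G' i := if i \in E then G i else 1.
transitivity (\prod_i (F' i + G' i)).
  rewrite big_mkcond; apply: eq_bigr => i _; rewrite /F' /G'.
  by case: ifP => // _; rewrite add0r.
rewrite bigA_distr (bigID (fun J : {set I} => J \subset E)) /= [X in _ + X]big1 ?addr0.
  apply: eq_bigr => J JE; rewrite [in RHS]big_mkcond; apply: eq_bigr => i _.
  rewrite /F' /G'; case: ifP => iJ; last by case: ifP.
  by rewrite (subsetP JE).
move=> J /subsetPn[i iJ iE]; rewrite (bigD1 i) //= iJ /F' (negPf iE).
by rewrite mul0r.
Qed.

(** For [b = 1 - a] this is the law of a binomial random subset of [E]. Keeping [b] free also covers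
    generating functions and unnormalised weights. *)
Definition bern (R : pzSemiRingType) (I : finType) (a b : R) (E H : {set I}) : R :=
  a ^+ #|H| * b ^+ #|E :\: H|.

Lemma bernE (R : comPzSemiRingType) (I : finType) (a b : R) (E H : {set I}) :
  H \subset E -> bern a b E H = \prod_(i in E) (if i \in H then a else b).
Proof.
move=> HE; rewrite (big_setID H) /= (setIidPr HE) /bern; congr (_ * _).
  by rewrite -prodr_const; apply: eq_bigr => i ->.
by rewrite -prodr_const; apply: eq_bigr => i; rewrite inE => /andP[/negPf->].
Qed.

Lemma sum_bern (R : comPzSemiRingType) (I : finType) (a b : R) (E : {set I}) :
  \sum_(H : {set I} | H \subset E) bern a b E H = (a + b) ^+ #|E|.
Proof.
rewrite -prodr_const prodrD_subset; apply: eq_bigr => H HE.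
by rewrite bernE.
Qed.

Lemma sum_bernX (R : comPzSemiRingType) (I : finType) (a b c : R) (E : {set I}) :
  \sum_(H : {set I} | H \subset E) bern a b E H * c ^+ #|H| = (a * c + b) ^+ #|E|.
Proof.
by rewrite -sum_bern; apply: eq_bigr => H _; rewrite /bern exprMn mulrAC.
Qed.

Lemma bern_ge0 (R : numDomainType) (I : finType) (a b : R) (E H : {set I}) :
  0 <= a -> 0 <= b -> 0 <= bern a b E H.
Proof. by move=> a0 b0; rewrite mulr_ge0 ?exprn_ge0. Qed.

Lemma card_setU_star (T : finType) (v : T) (A D : {set T}) (H : {set {set T}}) :
  D \subset A :\ v -> H \subset pairs (A :\ v) ->
  #|H :|: star v D| = (#|H| + #|D|)%N.
Proof.
move=> DA HA; have vD : v \notin D by apply/negP=> /(subsetP DA); rewrite !inE eqxx.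
rewrite cardsU card_star // (_ : H :&: _ = set0) ?cards0 ?subn0 //.
by apply/eqP; rewrite setI_eq0; apply: disjoint_star HA.
Qed.

Lemma pairs_setD1 (T : finType) (v : T) (A : {set T}) :
  v \in A -> pairs A = pairs (A :\ v) :|: star v (A :\ v).
Proof.
move=> vA; apply/eqP; rewrite eqEsubset subUset star_sub_pairs // pairs_sub ?subD1set //.
rewrite !andbT; apply/subsetP=> e eA; rewrite inE.
have [ve|ve] := boolP (v \in e); apply/orP; [right|left].
  by have [u [uA ->]] := pairs_star eA ve; apply/imsetP; exists u.
by move: eA; rewrite !inE subsetD1 ve andbT.
Qed.

Lemma bern_peel (R : comPzSemiRingType) (a b : R) (T : finType) (v : T)
    (A D : {set T}) (H : {set {set T}}) :
  v \in A -> D \subset A :\ v -> H \subset pairs (A :\ v) ->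
  bern a b (pairs A) (H :|: star v D) =
  bern a b (A :\ v) D * bern a b (pairs (A :\ v)) H.
Proof.
move=> vA DA HA; rewrite /bern (card_setU_star DA HA).
have -> : #|pairs A :\: (H :|: star v D)| =
   (#|pairs (A :\ v) :\: H| + #|(A :\ v) :\: D|)%N.
  have HD : H :|: star v D \subset pairs A.
    by rewrite (pairs_setD1 vA) setUSS // imsetS.
  rewrite (cardsD (pairs A)) (cardsD (A :\ v)) (cardsD (pairs (A :\ v))).
  rewrite (setIidPr HD) (setIidPr DA) (setIidPr HA).
  rewrite (card_setU_star DA HA) (pairs_setD1 vA) (card_setU_star (subxx _) (subxx _)).
  by move: (subset_leq_card DA) (subset_leq_card HA); lia.
by rewrite !exprD mulrACA mulrC.
Qed.

(** The extracted power of [b] is the weight of having no edge from [v] to the other [#|U| - 1]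
    vertices of [U]. *)
Lemma bern_setD (R : comPzSemiRingType) (a b : R) (T : finType) (v : T)
    (A U D : {set T}) :
  v \in U -> U \subset A -> D \subset A :\: U ->
  bern a b (A :\ v) D = b ^+ #|U|.-1 * bern a b (A :\: U) D.
Proof.
move=> vU UA DA; rewrite /bern mulrCA -exprD; congr (_ * b ^+ _).
have UvE : #|U| = #|U :\ v|.+1 by rewrite (cardsD1 v) vU.
have DAv : D \subset A :\ v.
  by apply: subset_trans DA _; apply: setDS; rewrite sub1set.
rewrite (cardsD (A :\ v)) (cardsD (A :\: U)) (setIidPr DA) (setIidPr DAv).
have AvE : #|A| = #|A :\ v|.+1 by rewrite (cardsD1 v) (subsetP UA).
rewrite (cardsD A U) (setIidPr UA).
move: (subset_leq_card DA) (subset_leq_card UA).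
by rewrite (cardsD A U) (setIidPr UA) AvE UvE /=; clear; lia.
Qed.

(** * Probability of being a small forest *)

(* Jensen's inequality for the exponential. *)
Lemma expR_sum_ge (R : realType) (I : finType) (P : pred I) (w x : I -> R) :
  (forall i, P i -> 0 <= w i) -> \sum_(i | P i) w i = 1 ->
  expR (\sum_(i | P i) w i * x i) <= \sum_(i | P i) w i * expR (x i).
Proof.
move=> w0 w1; set y := \sum_(i | P i) w i * x i.
suff : \sum_(i | P i) w i * (expR y * (1 + (x i - y))) <=
       \sum_(i | P i) w i * expR (x i).
  apply: le_trans; rewrite (_ : \sum_(i | P i) _ =
    expR y * (\sum_(i | P i) w i * x i) + expR y * (1 - y) * \sum_(i | P i) w i).
    by rewrite w1 -/y mulr1 -mulrDr addrC subrK mulr1.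
  by rewrite !mulr_sumr -big_split; apply: eq_bigr => i _ /=; ring.
apply: ler_sum => i Pi; apply: ler_wpM2l; first exact: w0.
have -> : expR (x i) = expR y * expR (x i - y) by rewrite -expRD addrC subrK.
by rewrite ler_wpM2l ?expR_ge0 ?expR_ge1Dx.
Qed.

(** The generating function of a binomial variable at [lam^-1] is at most that of a Poisson variable
    of mean [lam], because [1 + x <= expR x]; and [lam * (lam^-1 - 1) = 1 - lam]. *)
Lemma bern_moment (R : realType) (I : finType) (lam p : R) (X : {set I}) :
  0 < lam < 1 -> 0 <= p <= lam -> p * #|X|%:R <= lam ->
  \sum_(D : {set I} | D \subset X) bern p (1 - p) X D * lam^-1 ^+ #|D| <=
  expR (1 - lam).
Proof.
move=> /andP[l0 l1] /andP[p0 pl] pX; rewrite sum_bernX.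
have q1 : 1 <= lam^-1 by rewrite invf_ge1 // ltW.
apply: (@le_trans _ _ (expR (p * (lam^-1 - 1)) ^+ #|X|)).
  rewrite lerXn2r ?nnegrE ?expR_ge0 //.
    by rewrite addr_ge0 ?mulr_ge0 ?invr_ge0 ?(ltW l0) ?subr_ge0 ?(le_trans pl) // ltW.
  by apply: le_trans (expR_ge1Dx _); rewrite mulrBr mulr1; lra.
rewrite -expRM_natl ler_expR.
have -> : 1 - lam = lam * (lam^-1 - 1) by field; rewrite gt_eqF.
by rewrite mulrA (mulrC _ p) ler_wpM2r // subr_ge0.
Qed.

(** Averaging over [D] preserves the shape of the lower bound: Jensen moves the average inside the
    exponential, and [bern_moment] replaces [lam^-1 ^+ #|D|] by [expR (1 - lam)] in both places. *)
Lemma bern_step (R : realType) (I : finType) (lam p c0 c1 e0 e1 : R)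
    (X : {set I}) (f : {set I} -> R) :
  0 < lam < 1 -> 0 <= p <= lam -> p * #|X|%:R <= lam -> 0 <= c1 -> 0 <= e1 ->
  (forall D : {set I}, D \subset X ->
     expR (- (c0 + c1 * lam^-1 ^+ #|D|)) - e0 - e1 * lam^-1 ^+ #|D| <= f D) ->
  expR (- (c0 + c1 * expR (1 - lam))) - e0 - e1 * expR (1 - lam) <=
  \sum_(D : {set I} | D \subset X) bern p (1 - p) X D * f D.
Proof.
move=> hl hp pX c10 e10 hf; have mom := bern_moment hl hp pX.
have w1 : \sum_(D : {set I} | D \subset X) bern p (1 - p) X D = 1.
  by rewrite sum_bern addrC subrK expr1n.
have w0 (D : {set I}) : D \subset X -> 0 <= bern p (1 - p) X D.
  move=> _; case/andP: hl hp => _ l1 /andP[p0 pl]; apply: bern_ge0 => //.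
  by rewrite subr_ge0 (le_trans pl) // ltW.
apply: (@le_trans _ _ (\sum_(D : {set I} | D \subset X) bern p (1 - p) X D *
   (expR (- (c0 + c1 * lam^-1 ^+ #|D|)) - e0 - e1 * lam^-1 ^+ #|D|))); last first.
  by apply: ler_sum => D DX; rewrite ler_wpM2l ?w0 ?hf.
rewrite (_ : \sum_(D : {set I} | _) _ =
   \sum_(D : {set I} | D \subset X) bern p (1 - p) X D *
      expR (- (c0 + c1 * lam^-1 ^+ #|D|))
   - e0 * \sum_(D : {set I} | D \subset X) bern p (1 - p) X D
   - e1 * \sum_(D : {set I} | D \subset X) bern p (1 - p) X D * lam^-1 ^+ #|D|);
  last first.
  by rewrite 2!mulr_sumr -2!sumrB; apply: eq_bigr => D _; ring.
apply: lerB; last exact: ler_wpM2l.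
rewrite w1 mulr1; apply: lerB => //.
apply: le_trans (expR_sum_ge _ w0 w1); rewrite ler_expR.
rewrite (_ : \sum_(D : {set I} | _) _ =
   - (c0 * \sum_(D : {set I} | D \subset X) bern p (1 - p) X D
   + c1 * \sum_(D : {set I} | D \subset X) bern p (1 - p) X D * lam^-1 ^+ #|D|)).
  by rewrite w1 mulr1 lerN2 lerD2l ler_wpM2l.
rewrite 2!mulr_sumr -big_split -sumrN; apply: eq_bigr => D _ /=; ring.
Qed.

Definition tight_mass (R : realType) (p : R) (T : finType) (k m : nat)
    (A U : {set T}) : R :=
  \sum_(H : {set {set T}} | (H \subset pairs A) && tight k m A U H)
     bern p (1 - p) (pairs A) H.

Lemma tight_mass_ge0 (R : realType) (p : R) (T : finType) (k m : nat)
    (A U : {set T}) : 0 <= p <= 1 -> 0 <= tight_mass p k m A U.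
Proof.
by move=> /andP[p0 p1]; apply: sumr_ge0 => H _; rewrite bern_ge0 ?subr_ge0.
Qed.

(** With [U] empty a new tree is begun at [v], which resets the remaining size to [k] and uses one
    unit of it. *)
Lemma tight_mass_root (R : realType) (p : R) (T : finType) (k m : nat)
    (A : {set T}) (v : T) : (0 < k)%N -> v \in A ->
  tight_mass p k m A set0 =
  \sum_(D : {set T} | D \subset A :\ v)
     bern p (1 - p) (A :\ v) D * tight_mass p k k.-1 (A :\ v) D.
Proof.
move=> k0 vA.
transitivity (\sum_(H : {set {set T}} | (H \subset pairs A) && good k A H)
   bern p (1 - p) (pairs A) H).
  by apply: eq_bigl => H; have [HA|//] := boolP (H \subset _); rewrite tight0.
rewrite (big_good_peel _ _ k0 vA); apply: eq_bigr => D DA; rewrite mulr_sumr.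
by apply: eq_bigr => H /andP[HA _]; rewrite bern_peel.
Qed.

Lemma tight_mass_peel (R : realType) (p : R) (T : finType) (k m : nat)
    (A U : {set T}) (v : T) : (0 < m <= k)%N -> v \in U -> U \subset A ->
  tight_mass p k m A U = (1 - p) ^+ #|U|.-1 *
  \sum_(D : {set T} | D \subset A :\: U)
     bern p (1 - p) (A :\: U) D * tight_mass p k m.-1 (A :\ v) ((U :\ v) :|: D).
Proof.
move=> mk vU UA; rewrite /tight_mass (big_tight_peel _ _ mk vU UA) mulr_sumr.
apply: eq_bigr => D DA; rewrite mulrA -(bern_setD _ _ vU UA DA) mulr_sumr.
apply: eq_bigr => H /andP[HA _]; rewrite bern_peel //; first exact: (subsetP UA).
by apply: subset_trans DA _; apply: setDS; rewrite sub1set.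
Qed.

Lemma tight_mass_set0 (R : realType) (p : R) (T : finType) (k m : nat) :
  tight_mass p k m (@set0 T) set0 = 1.
Proof.
rewrite /tight_mass (big_pred1 set0) => [|H].
  by rewrite /bern pairs0 setD0 cards0 !expr0 mulr1.
rewrite pairs0 subset0 /=; case: (eqVneq H set0) => [->|//].
rewrite tight0 ?sub0set //=; suff -> : good k (@set0 T) set0 by [].
by apply/goodP => B; rewrite subset0 => ->.
Qed.

(* With s = expR (1 - lam), processing a vertex of U multiplies the expectation of
   lam^-1 ^+ #|U| by at most lam * s < 1. This makes the last two subtracted
   terms, which account for trees with more than k vertices, a supermartingale;
   in the first exponent the same potential pays for the cost
   (#|U| - 1) * p / (1 - lam) of having no edge from the processed vertex to the
   rest of U. *)
Lemma tight_mass_ge (R : realType) (lam p beta : R) (T : finType) (k : nat) :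
  0 < lam < 1 -> 0 <= p <= lam -> (0 < k)%N -> 0 <= beta ->
  (forall u : nat, u%:R / (1 - lam) <=
     beta * (1 - lam * expR (1 - lam)) * lam^-1 ^+ u) ->
  forall (A U : {set T}) (m : nat),
  (m <= k)%N -> U \subset A -> p * #|A|%:R <= lam ->
  expR (- (p * beta * (expR (1 - lam) * #|A|%:R + lam^-1 ^+ #|U|)))
  - (lam * expR (1 - lam)) ^+ k * lam^-1 * #|A|%:R
  - (U != set0)%:R * ((lam * expR (1 - lam)) ^+ m * lam^-1 ^+ #|U|)
  <= tight_mass p k m A U.
Proof.
move=> hl hp k0 b0 hb A; have [a Aa] := ubnP #|A|.
elim: a A Aa => // a IH A Aa U m mk UA pA.
case/andP: (hl) => l0 l1; case/andP: (hp) => p0 pl.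
have p01 : 0 <= p <= 1 by rewrite p0 (le_trans pl) // ltW.
set s := expR (1 - lam) in hb IH *; set q := lam^-1 in hb IH *.
have s1 : 1 <= s by rewrite -expR0 ler_expR subr_ge0 ltW.
have q1 : 1 <= q by rewrite invf_ge1 // ltW.
have q0 : 0 < q by rewrite invr_gt0.
have s0 : 0 < s by exact: expR_gt0.
have ls0 : 0 <= lam * s by rewrite mulr_ge0 ?ltW.
have lq : lam * q = 1 by rewrite mulfV // gt_eqF.
have pb0 : 0 <= p * beta by rewrite mulr_ge0.
have e0 : 0 <= (lam * s) ^+ k * q by rewrite mulr_ge0 ?exprn_ge0 // ltW.
have Asub v : v \in A -> #|A| = #|A :\ v|.+1 by move=> vA; rewrite (cardsD1 v) vA.
have [U0|/set0Pn[v vU]] := eqVneq U set0.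
  rewrite U0 /= mulr0n mul0r subr0 cards0 expr0.
  have [A0|/set0Pn[v vA]] := eqVneq A set0.
    rewrite A0 cards0 !mulr0 subr0 add0r mulr1 tight_mass_set0 -expR0 ler_expR.
    by rewrite oppr_le0.
  rewrite (tight_mass_root _ _ k0 vA).
  have pAv : p * #|A :\ v|%:R <= lam.
    by apply: le_trans pA; rewrite ler_wpM2l // ler_nat subset_leq_card // subD1set.
  set aa : R := #|A :\ v|%:R in pAv *.
  have step : expR (- (p * beta * (s * aa) + p * beta * s))
      - (lam * s) ^+ k * q * aa - (lam * s) ^+ k.-1 * s <=
      \sum_(D : {set T} | D \subset A :\ v)
        bern p (1 - p) (A :\ v) D * tight_mass p k k.-1 (A :\ v) D.
    apply: bern_step => //; first exact: exprn_ge0.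
    move=> D DA; apply: le_trans (IH (A :\ v) _ D k.-1 _ DA pAv).
    + rewrite -/aa -/q mulrDr lerB // ler_piMl //.
        by rewrite mulr_ge0 ?exprn_ge0 // ltW.
      by case: (_ != _).
    + by move: Aa; rewrite (Asub v vA).
    + exact: leq_pred.
  apply: le_trans step; rewrite (Asub v vA) -natr1 -/aa.
  (* Since [lam * q = 1], opening a tree costs exactly the amount by which the second subtracted
     term shrinks when [#|A|] drops by one. *)
  have -> : (lam * s) ^+ k.-1 * s = (lam * s) ^+ k * q.
    case: (k) k0 => // k' _ /=; rewrite exprS.
    rewrite (_ : _ * q = (lam * q) * ((lam * s) ^+ k' * s)); last by ring.
    by rewrite lq mul1r.
  rewrite [leRHS](_ : _ = expR (- (p * beta * (s * aa) + p * beta * s)) -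
     (lam * s) ^+ k * q * (aa + 1)); last by ring.
  apply: lerB => //; rewrite ler_expR lerN2.
  by rewrite -mulrDr ler_wpM2l //; lra.
rewrite /= mulr1n mul1r.
have qn n : 1 <= q ^+ n by rewrite exprn_ege1.
(* If [m < #|U|] the claimed bound is not positive: [(lam * s) ^+ m * q ^+ #|U|] is at least
   [(lam * s * q) ^+ m = s ^+ m >= 1], while the exponential is at most 1. *)
have [mU|mU] := leqP m #|U|.-1.
  apply: le_trans (tight_mass_ge0 _ _ _ _ p01).
  rewrite subr_le0; apply: (@le_trans _ _ 1).
    rewrite lerBlDr (_ : 1 = expR 0) ?expR0 //; apply: (@le_trans _ _ 1).
      rewrite -[leRHS]expR0 ler_expR oppr_le0 mulr_ge0 // addr_ge0 //.
        by rewrite mulr_ge0 // ltW.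
      by rewrite exprn_ge0 // ltW.
    by rewrite lerDl mulr_ge0.
  apply: (@le_trans _ _ ((lam * s) ^+ m * q ^+ m)).
    by rewrite -exprMn mulrAC lq mul1r exprn_ege1.
  rewrite ler_wpM2l ?exprn_ge0 //; apply: ler_weXn2l => //.
  exact: leq_trans mU (leq_pred _).
have m0 : (0 < m)%N by apply: leq_ltn_trans mU.
have vA := subsetP UA _ vU.
have UU : #|U| = #|U :\ v|.+1 by rewrite (cardsD1 v) vU.
rewrite (@tight_mass_peel _ p _ k m A U v) ?m0 //.
have pAv : p * #|A :\ v|%:R <= lam.
  by apply: le_trans pA; rewrite ler_wpM2l // ler_nat subset_leq_card // subD1set.
have pAU : p * #|A :\: U|%:R <= lam.
  by apply: le_trans pA; rewrite ler_wpM2l // ler_nat subset_leq_card // subsetDl.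
set u' := #|U :\ v|; rewrite UU -/u' /=.
set aa : R := #|A :\ v|%:R in pAv *.
have DUv (D : {set T}) : D \subset A :\: U -> #|U :\ v :|: D| = (u' + #|D|)%N.
  move=> DA; rewrite cardsU (_ : _ :&: _ = set0) ?cards0 ?subn0 //.
  apply/setP=> x; rewrite !inE; apply/negP=> /andP[/andP[_ xU] /(subsetP DA)].
  by rewrite inE xU.
have step : expR (- (p * beta * (s * aa) + p * beta * q ^+ u' * s))
    - (lam * s) ^+ k * q * aa - (lam * s) ^+ m.-1 * q ^+ u' * s <=
  \sum_(D : {set T} | D \subset A :\: U)
     bern p (1 - p) (A :\: U) D * tight_mass p k m.-1 (A :\ v) (U :\ v :|: D).
  apply: bern_step => //.
  - by rewrite mulr_ge0 // exprn_ge0 // ltW.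
  - by rewrite mulr_ge0 // exprn_ge0 // ltW.
  move=> D DA; apply: le_trans (IH (A :\ v) _ (U :\ v :|: D) m.-1 _ _ pAv).
  - rewrite -/aa -/q DUv // exprD.
    rewrite (_ : _ * (s * aa + _) =
       p * beta * (s * aa) + p * beta * q ^+ u' * q ^+ #|D|); last by ring.
    apply: lerB => //; rewrite -[leRHS]mulrA.
    by rewrite ler_piMl ?mulr_ge0 ?exprn_ge0 ?(ltW q0) //; case: (_ != _).
  - by move: Aa; rewrite (Asub v vA).
  - exact: leq_trans (leq_pred m) mk.
  - rewrite subUset setSD //=; apply: subset_trans DA _.
    by apply: setDS; rewrite sub1set.
have zE : (lam * s) ^+ m.-1 * q ^+ u' * s = (lam * s) ^+ m * q ^+ u'.+1.
  case: (m) m0 => // m' _ /=; rewrite !exprS.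
  rewrite [RHS](_ : _ = (lam * q) * ((lam * s) ^+ m' * q ^+ u' * s)); last by ring.
  by rewrite lq mul1r.
rewrite zE in step.
apply: le_trans (ler_wpM2l (exprn_ge0 _ _) step); last first.
  by rewrite subr_ge0; case/andP: p01.
rewrite (Asub v vA) -natr1 -/aa.
have pw1 : (1 - p) ^+ u' <= 1.
  by rewrite exprn_ile1 ?gerBl ?subr_ge0 //; case/andP: p01.
have pw0 : 0 <= (1 - p) ^+ u' by rewrite exprn_ge0 // subr_ge0; case/andP: p01.
have z0 : 0 <= (lam * s) ^+ m * q ^+ u'.+1 by rewrite mulr_ge0 ?exprn_ge0 // ltW.
rewrite 2!mulrBr; apply: lerB; last exact: ler_piMl.
apply: lerB; last first.
  apply: (@le_trans _ _ ((lam * s) ^+ k * q * aa)).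
    by apply: ler_piMl => //; rewrite mulr_ge0.
  by rewrite ler_wpM2l // lerDl.
(* From [(1 - p)^-1 = 1 + p / (1 - p) <= expR (p / (1 - p))] and [p <= lam]. *)
have pexp : expR (- (p * (u'%:R / (1 - lam)))) <= (1 - p) ^+ u'.
  rewrite (_ : - _ = u'%:R * (- (p / (1 - lam)))); last by ring.
  rewrite expRM_natl lerXn2r ?nnegrE ?expR_ge0 ?subr_ge0 //; first by case/andP: p01.
  have p1 : 0 < 1 - p by rewrite subr_gt0 (le_lt_trans pl).
  rewrite expRN -[leRHS]invrK lef_pV2 ?posrE ?expR_gt0 ?invr_gt0 //.
  apply: le_trans (expR_ge1Dx _); rewrite -lerBlDl.
  rewrite (_ : _ - 1 = p / (1 - p)); last by field; rewrite gt_eqF.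
  rewrite ler_wpM2l // lef_pV2 ?posrE // ?subr_gt0 //.
  by rewrite lerD2l lerN2.
apply: le_trans (ler_wpM2r (expR_ge0 _) pexp).
rewrite -expRD ler_expR.
rewrite (_ : - _ + - _ = - (p * (u'%:R / (1 - lam) +
   (beta * (s * aa) + beta * q ^+ u' * s)))); last by ring.
rewrite lerN2 -[leRHS]mulrA ler_wpM2l //.
(* The step turns the potential [q ^+ u'.+1] into [lam * s * q ^+ u'.+1]; by [hb], the lost fraction
   [1 - lam * s], times [beta], pays for [u' / (1 - lam)]. *)
have := hb u'.
have : q ^+ u' * s = lam * s * q ^+ u'.+1.
  rewrite exprS [RHS](_ : _ = lam * q * (q ^+ u' * s)); last by ring.
  by rewrite lq mul1r.
have : q ^+ u' <= q ^+ u'.+1 by rewrite ler_weXn2l.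
have bs : 0 <= beta * s by rewrite mulr_ge0 // ltW.
have lsb : 0 <= beta * (1 - lam * s).
  by have := hb 0%N; rewrite mul0r expr0 mulr1.
move=> qq e1 hbu.
have h2 : beta * (1 - lam * s) * q ^+ u' <= beta * (1 - lam * s) * q ^+ u'.+1.
  by rewrite ler_wpM2l.
rewrite -[beta * _ * s]mulrA e1.
apply: (@le_trans _ _ (beta * (1 - lam * s) * q ^+ u'.+1 +
   (beta * (s * aa) + beta * (lam * s * q ^+ u'.+1)))).
  by rewrite lerD2r (le_trans hbu).
rewrite (_ : _ + _ = beta * (s * aa + q ^+ u'.+1)); last by ring.
by rewrite ler_wpM2l // lerD2r ler_wpM2l ?(ltW s0) // lerDl.
Qed.

(** * Weighted sums over small forests *)

Lemma cover_star (T : finType) (v : T) (D : {set T}) :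
  cover (star v D) = if D == set0 then set0 else v |: D.
Proof.
apply/setP=> x; have [->|/set0Pn[u uD]] := eqVneq.
  rewrite inE; apply/negP=> /bigcupP[e /imsetP[u]]; by rewrite inE.
apply/bigcupP/setU1P => [[e /imsetP[w wD ->]]|].
  by rewrite !inE => /orP[]/eqP->; [left|right].
case=> [->|xD].
  by exists [set v; u]; rewrite ?inE ?eqxx //; apply/imsetP; exists u.
by exists [set v; x]; rewrite ?inE ?eqxx ?orbT //; apply/imsetP; exists x.
Qed.

Lemma cover_setU (T : finType) (H K : {set {set T}}) :
  cover (H :|: K) = cover H :|: cover K.
Proof. exact: bigcup_setU. Qed.

Lemma cover_pairs (T : finType) (A : {set T}) (H : {set {set T}}) :
  H \subset pairs A -> cover H \subset A.
Proof.
move=> HA; apply/bigcupsP => e /(subsetP HA); by rewrite inE => /andP[].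
Qed.

(** [cover H] is the set of non-isolated vertices of [H]. Each vertex outside [U] is counted once,
    at its discovery: those of [D] now, the others later. *)
Lemma card_cover_peel (T : finType) (v : T) (A U D : {set T})
    (H : {set {set T}}) :
  v \in U -> D \subset A :\: U -> H \subset pairs (A :\ v) ->
  #|cover (H :|: star v D) :\: U| = (#|D| + #|cover H :\: (U :\ v :|: D)|)%N.
Proof.
move=> vU /subsetP DA /cover_pairs/subsetP cH.
have DU x : x \in D -> x \notin U by move/DA; rewrite inE => /andP[].
have -> : cover (H :|: star v D) :\: U = D :|: (cover H :\: (U :\ v :|: D)).
  apply/setP=> x; rewrite cover_setU cover_star !inE.
  have [->|xv] /= := eqVneq x v.
    have -> : v \in D = false by apply/negP=> /DU; rewrite vU.
    have -> : v \in cover H = false by apply/negP=> /cH; rewrite !inE eqxx.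
    by rewrite vU.
  have [xD|xD] := boolP (x \in D).
    rewrite DU //=; case: eqP => [D0|_]; first by rewrite D0 inE in xD.
    by rewrite !inE xD !orbT.
  have -> : (x \in if D == set0 then set0 else v |: D) = false.
    by case: ifP => _; rewrite !inE // (negPf xv) (negPf xD).
  by rewrite !orbF.
rewrite cardsU (_ : D :&: _ = set0) ?cards0 ?subn0 //.
by apply/setP=> x; rewrite !inE; case: (x \in D) => //=; rewrite orbT.
Qed.

Lemma sum_exprn_card (R : realType) (I : finType) (x c : R) (X : {set I}) :
  0 <= x -> x * #|X|%:R <= c ->
  \sum_(D : {set I} | D \subset X) x ^+ #|D| <= expR c.
Proof.
move=> x0 xc; rewrite (_ : \sum_(D : {set I} | _) _ = (x + 1) ^+ #|X|); last first.
  by rewrite -sum_bern; apply: eq_bigr => D _; rewrite /bern expr1n mulr1.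
apply: (@le_trans _ _ (expR x ^+ #|X|)).
  rewrite lerXn2r ?nnegrE ?expR_ge0 ?addr_ge0 //.
  by rewrite addrC expR_ge1Dx.
by rewrite -expRM_natl ler_expR mulrC.
Qed.

(* Each discovered vertex has weight t * rho <= (r / expR 1) / #|A|, so that the
   factor expR 1 / r per vertex of U reproduces itself: summing over D gives at
   most expR 1. This replaces the bound j ^ (j - 2) on the number of trees. *)
Lemma forest_sum_le (R : realType) (t rho r : R) (T : finType) (k : nat)
    (A : {set T}) :
  0 <= t -> 0 <= rho -> 1 <= r -> (0 < k)%N ->
  t * rho * expR 1 * #|A|%:R <= r ->
  \sum_(H : {set {set T}} | (H \subset pairs A) && good k A H)
     t ^+ #|H| * rho ^+ #|cover H| <= (1 + expR 1 * rho * r ^+ k) ^+ #|A| /\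
  forall (U : {set T}) (m : nat), U \subset A -> (m <= k)%N ->
  \sum_(H : {set {set T}} | (H \subset pairs A) && tight k m A U H)
     t ^+ #|H| * rho ^+ #|cover H :\: U| <=
  r ^+ m * (expR 1 / r) ^+ #|U| * (1 + expR 1 * rho * r ^+ k) ^+ #|A|.
Proof.
move=> t0 rho0 r1 k0; have [a Aa] := ubnP #|A|.
elim: a A Aa => // a IH A Aa tA.
have e0 : 0 < expR 1 :> R by exact: expR_gt0.
set e := expR 1 in e0 IH tA *.
have r0 : 0 < r by apply: lt_le_trans r1.
set z := 1 + e * rho * r ^+ k in IH *.
have z1 : 1 <= z by rewrite lerDl mulr_ge0 ?mulr_ge0 ?exprn_ge0 // ltW.
have z0 : 0 <= z by apply: le_trans z1.
set y := t * rho * (e / r).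
have er0 : 0 <= e / r by rewrite divr_ge0 ?ltW.
have y0 : 0 <= y by rewrite /y mulr_ge0 // mulr_ge0.
have yE n : y ^+ n = (t * rho) ^+ n * (e / r) ^+ n by exact: exprMn.
have yA : y * #|A|%:R <= 1.
  rewrite /y (_ : _ * _ = t * rho * e * #|A|%:R / r); last by ring.
  by rewrite ler_pdivrMr // mul1r.
have ysum (X : {set T}) : X \subset A ->
    \sum_(D : {set T} | D \subset X) y ^+ #|D| <= e.
  move=> XA; apply: sum_exprn_card => //; apply: le_trans yA.
  by rewrite ler_wpM2l // ler_nat subset_leq_card.
have Asub v : v \in A -> #|A| = #|A :\ v|.+1 by move=> vA; rewrite (cardsD1 v) vA.
have IHv v : v \in A -> t * rho * e * #|A :\ v|%:R <= r.
  move=> vA; apply: le_trans tA; rewrite ler_wpM2l ?mulr_ge0 //; first exact: ltW.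
  by rewrite ler_nat subset_leq_card // subD1set.
have good_le : \sum_(H : {set {set T}} | (H \subset pairs A) && good k A H)
     t ^+ #|H| * rho ^+ #|cover H| <= z ^+ #|A|.
  have [A0|/set0Pn[v vA]] := eqVneq A set0.
    rewrite A0 cards0 expr0 (bigD1 set0) /=; last first.
      rewrite sub0set; apply/goodP => B; by rewrite subset0 => ->.
    rewrite /cover big_set0 !cards0 !expr0 mulr1 big1 ?addr0 // => H.
    by rewrite pairs0 subset0 => /andP[/andP[->]].
  have aA : (#|A :\ v| < a)%N by move: Aa; rewrite (Asub v vA).
  have [IH1 IH2] := IH _ aA (IHv v vA).
  rewrite (big_good_peel _ _ k0 vA) (Asub v vA) exprSr.
  (* An isolated root contributes only [z ^+ #|A :\ v|]; a root with neighbours is itself covered,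
     whence the factor [rho]. Summing over [D] yields one more factor [z]. *)
  apply: (@le_trans _ _ (\sum_(D : {set T} | D \subset A :\ v)
      ((if D == set0 then z ^+ #|A :\ v| else 0) +
       rho * r ^+ k * z ^+ #|A :\ v| * y ^+ #|D|))).
    apply: ler_sum => D DA.
    have pos : 0 <= rho * r ^+ k * z ^+ #|A :\ v| * y ^+ #|D|.
      by rewrite !mulr_ge0 ?exprn_ge0 // ltW.
    have [D0|Dn0] := eqVneq D set0.
      apply: (@le_trans _ _ (z ^+ #|A :\ v|)); last by rewrite lerDl.
      apply: le_trans IH1; rewrite D0 (_ : star v set0 = set0); last exact: imset0.
      rewrite le_eqVlt; apply/orP; left; apply/eqP; apply: eq_big => [H|H _].
        by have [HA|//] := boolP (H \subset _); rewrite tight0.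
      by rewrite setU0.
    rewrite add0r.
    have := IH2 D k.-1 DA (leq_pred k).
    move=> /(ler_wpM2l (mulr_ge0 rho0 (exprn_ge0 #|D| (mulr_ge0 t0 rho0)))).
    rewrite mulr_sumr (_ : \sum_(H : {set {set T}} | _) _ =
       \sum_(H : {set {set T}} | (H \subset pairs (A :\ v)) &&
           tight k k.-1 (A :\ v) D H)
         t ^+ #|H :|: star v D| * rho ^+ #|cover (H :|: star v D)|).
      move=> h; apply: le_trans h _.
      rewrite [leLHS](_ : _ = rho * r ^+ k.-1 * z ^+ #|A :\ v| * y ^+ #|D|); last first.
        rewrite yE; ring.
      rewrite ler_wpM2r ?exprn_ge0 // ler_wpM2r ?exprn_ge0 // ler_wpM2l //.
      by rewrite ler_weXn2l // leq_pred.
    apply: eq_bigr => H /andP[HA _]; rewrite (card_setU_star DA HA).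
    have -> : #|cover (H :|: star v D)| = (#|D| + #|cover H :\: D|).+1.
      rewrite (cardsD1 v) cover_setU cover_star (negPf Dn0) !inE eqxx orbT.
      have := @card_cover_peel _ v A [set v] D H.
      rewrite !inE eqxx setDv set0U cover_setU cover_star (negPf Dn0) => -> //.
    rewrite exprS !exprD exprMn.
    by move: (t ^+ #|H|) (t ^+ #|D|) (rho ^+ #|D|) (rho ^+ #|_|) => *; ring.
  rewrite big_split /= -big_mkcondr /= (big_pred1 set0); last first.
    by move=> D /=; case: eqVneq => [->|]; rewrite ?sub0set ?andbF.
  rewrite -mulr_sumr /z mulrDr mulr1 lerD2l -/z.
  apply: le_trans (ler_wpM2l _ (ysum _ _)) _.
  - by rewrite !mulr_ge0 ?exprn_ge0 // ltW.
  - exact: subD1set.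
  by rewrite le_eqVlt; apply/orP; left; apply/eqP; ring.
split=> // U m UA mk.
have [U0|/set0Pn[v vU]] := eqVneq U set0.
  rewrite U0 cards0 expr0 mulr1.
  apply: (@le_trans _ _ (z ^+ #|A|)); last first.
    by rewrite ler_peMl ?exprn_ge0 // exprn_ege1.
  apply: le_trans good_le; rewrite le_eqVlt; apply/orP; left; apply/eqP.
  apply: eq_big => [H|H _]; last by rewrite setD0.
  by have [HA|//] := boolP (H \subset _); rewrite tight0.
have [mU|mU] := ltnP m #|U|.
  rewrite big1 ?mulr_ge0 ?exprn_ge0 //; first exact: ltW.
  by move=> H /andP[_ /(tight_card UA)]; rewrite leqNgt mU.
have UU : #|U| = #|U :\ v|.+1 by rewrite (cardsD1 v) vU.
have m0 : (0 < m)%N by apply: leq_trans mU; rewrite UU.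
have vA := subsetP UA _ vU.
have aA : (#|A :\ v| < a)%N by move: Aa; rewrite (Asub v vA).
have [_ IH2] := IH _ aA (IHv v vA).
rewrite (@big_tight_peel _ _ _ _ k m v) ?m0 //.
apply: (@le_trans _ _ (\sum_(D : {set T} | D \subset A :\: U)
   r ^+ m.-1 * (e / r) ^+ #|U :\ v| * z ^+ #|A :\ v| * y ^+ #|D|)).
  apply: ler_sum => D DA.
  have DAv : D \subset A :\ v.
    by apply: subset_trans DA _; apply: setDS; rewrite sub1set.
  have UDA : U :\ v :|: D \subset A :\ v by rewrite subUset setSD.
  have := IH2 (U :\ v :|: D) m.-1 UDA (leq_trans (leq_pred m) mk).
  move=> /(ler_wpM2l (exprn_ge0 #|D| (mulr_ge0 t0 rho0))).
  rewrite mulr_sumr (_ : \sum_(H : {set {set T}} | _) _ =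
     \sum_(H : {set {set T}} | (H \subset pairs (A :\ v)) &&
         tight k m.-1 (A :\ v) (U :\ v :|: D) H)
       t ^+ #|H :|: star v D| * rho ^+ #|cover (H :|: star v D) :\: U|).
    move=> h; apply: le_trans h _.
    have -> : #|U :\ v :|: D| = (#|U :\ v| + #|D|)%N.
      rewrite cardsU (_ : _ :&: _ = set0) ?cards0 ?subn0 //.
      apply/setP=> x; rewrite !inE; apply/negP=> /andP[/andP[_ xU] /(subsetP DA)].
      by rewrite inE xU.
    rewrite le_eqVlt; apply/orP; left; apply/eqP.
    by rewrite exprD yE; ring.
  apply: eq_bigr => H /andP[HA _]; rewrite (card_setU_star DAv HA).
  rewrite (card_cover_peel vU DA HA) !exprD exprMn.
  by move: (t ^+ #|H|) (t ^+ #|D|) (rho ^+ #|D|) (rho ^+ #|_|) => *; ring.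
rewrite -mulr_sumr; apply: le_trans (ler_wpM2l _ (ysum _ _)) _.
- by rewrite !mulr_ge0 ?exprn_ge0 // ltW.
- exact: subsetDl.
rewrite UU (Asub v vA).
rewrite (_ : _ * e = r ^+ m * (e / r) ^+ #|U :\ v|.+1 * z ^+ #|A :\ v|).
  by rewrite ler_wpM2l ?mulr_ge0 ?exprn_ge0 // ?(ltW r0) // ler_weXn2l.
case: (m) m0 => // m' _ /=; rewrite !exprS; field; exact: lt0r_neq0.
Qed.

(** * Random graphs and moments of the truncated likelihood *)

(** The ratio of the binomials is the product of the [(n - i) / (N - i)] for [i < j], each at most
    [n / N]. *)
Lemma bin_sub_le (R : realFieldType) (N n j : nat) :
  (j <= n)%N -> (n <= N)%N ->
  ('C(N - j, n - j))%:R <= (n%:R / N%:R) ^+ j * ('C(N, n))%:R :> R.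
Proof.
move=> jn nN; elim: j jn => [|j IH] jn; first by rewrite !subn0 expr0 mul1r.
have jn' := ltnW jn; have {}IH := IH jn'.
have jN : (j < N)%N := leq_trans jn nN.
have N0 : 0 < N%:R :> R by rewrite ltr0n (leq_ltn_trans _ jN).
have Nj0 : 0 < (N - j)%:R :> R by rewrite ltr0n subn_gt0.
have step : ('C(N - j.+1, n - j.+1))%:R =
    (n - j)%:R / (N - j)%:R * ('C(N - j, n - j))%:R :> R.
  have := mul_bin_diag (N - j) (n - j.+1).
  rewrite -subnS (_ : (n - j.+1).+1 = (n - j)%N) ?subnSK // => /(congr1 (GRing.natmul (1 : R))).
  rewrite !natrM => h; apply: (mulfI (lt0r_neq0 Nj0)); rewrite h.
  by rewrite [RHS]mulrA (mulrC (N - j)%:R) divfK // lt0r_neq0.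
rewrite step exprS -[leRHS]mulrA ler_pM ?divr_ge0 //.
rewrite ler_pdivrMr // mulrAC ler_pdivlMr // -!natrM ler_nat.
by rewrite mulnBl mulnBr; apply: leq_sub2l; rewrite mulnC leq_mul2l nN orbT.
Qed.

Lemma card_sets_of_size (N n : nat) :
  #|[pred S : {set 'I_N} | #|S| == n]| = 'C(N, n).
Proof.
by rewrite -[N in RHS]card_ord -card_draws; apply: eq_card => S; rewrite !inE.
Qed.

(** Bounds the probability that a uniform [n]-set contains [V]; removing [V] injects these sets into
    the [(n - #|V|)]-subsets of its complement. *)
Lemma card_supersets_le (R : realFieldType) (T : finType) (n : nat) (V : {set T}) :
  (n <= #|T|)%N ->
  #|[set S : {set T} | (V \subset S) && (#|S| == n)]|%:R <=
  (n%:R / #|T|%:R) ^+ #|V| * ('C(#|T|, n))%:R :> R.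
Proof.
move=> nT; have [Vn|nV] := leqP #|V| n; last first.
  rewrite (_ : [set S : {set T} | _] = set0) ?cards0.
    by rewrite mulr_ge0 ?exprn_ge0 ?divr_ge0.
  apply/setP=> S; rewrite !inE; apply/negP=> /andP[/subset_leq_card VS /eqP nS].
  by move: VS; rewrite nS leqNgt nV.
apply: le_trans (bin_sub_le _ Vn nT); rewrite ler_nat.
have <- : #|~: V| = (#|T| - #|V|)%N by rewrite cardsCs setCK.
rewrite -cards_draws.
rewrite -(@card_in_imset _ _ (fun S : {set T} => S :\: V)); last first.
  move=> S S'; rewrite !inE => /andP[VS _] /andP[VS' _] /setP SS'.
  apply/setP=> x; have := SS' x; rewrite !inE.
  by case: (boolP (x \in V)) => // xV _; rewrite (subsetP VS) ?(subsetP VS').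
apply/subset_leq_card/subsetP=> X /imsetP[S]; rewrite !inE => /andP[VS /eqP nS] ->.
by rewrite subsetDr /= cardsD (setIidPr VS) nS.
Qed.

(** Independence: splitting [H] into its parts inside and outside [E1] factors the sum, and the
    outside part, which [g] does not see, sums out. *)
Lemma sum_prod_marginal (R : comPzSemiRingType) (I : finType) (E E1 : {set I})
    (a b : I -> R) (g : {set I} -> R) :
  E1 \subset E ->
  \sum_(H : {set I} | H \subset E)
     (\prod_(e in E) (if e \in H then a e else b e)) * g (H :&: E1) =
  (\sum_(K : {set I} | K \subset E1)
     (\prod_(e in E1) (if e \in K then a e else b e)) * g K) *
  \prod_(e in E :\: E1) (a e + b e).
Proof.
move=> E1E; rewrite prodrD_subset mulr_suml.
under [RHS]eq_bigr do rewrite mulr_sumr.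
rewrite pair_big /=.
rewrite (reindex_onto (fun p : {set I} * {set I} => p.1 :|: p.2)
   (fun H => (H :&: E1, H :\: E1))) /=; last by move=> H _; rewrite setID.
have EE e : (e \in E) = (e \in E1) || (e \in E :\: E1).
  by rewrite inE; case: (boolP (e \in E1)) => //= /(subsetP E1E).
apply: eq_big => [[K L] /=|[K L] /= /andP[KLE /eqP[KE LE]]].
  apply/andP/andP => [[KLE /eqP[KE LE]]|[KE LE]].
    by split; [rewrite -KE subsetIr|rewrite -LE setSD].
  rewrite subUset (subset_trans KE E1E) (subset_trans LE (subsetDl _ _)).
  move: LE; rewrite subsetD => /andP[_ LE1].
  split=> //; apply/eqP; congr (_, _).
    by rewrite setIUl (setIidPl KE) (disjoint_setI0 LE1) setU0.
  by rewrite setDUl (setDidPl LE1) (_ : K :\: E1 = set0) ?set0U //; apply/eqP; rewrite setD_eq0.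
rewrite KE mulrAC; congr (_ * _).
rewrite (big_setID E1) /= (setIidPr E1E); congr (_ * _); apply: eq_bigr => e eE.
  by rewrite -[in RHS]KE !inE eE andbT.
by move: eE; rewrite -[in RHS]LE !inE => /andP[->].
Qed.

(** * Random graphs as random edge sets *)

Definition edges (N : nat) (W : graph N) : {set {set 'I_N}} :=
  [set [set p.1; p.2] | p : 'I_N * 'I_N & val W p.1 p.2].

Lemma graph_sym (N : nat) (W : graph N) i j : val W i j = val W j i.
Proof.
by case: W => W /= /andP[/forallP/(_ i)/forallP/(_ j)/eqP ? _].
Qed.

Lemma graph_irr (N : nat) (W : graph N) i : val W i i = false.
Proof. by case: W => W /= /andP[_ /forallP/(_ i)/negPf]. Qed.

Lemma set2_eqP (T : finType) (a b i j : T) :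
  [set a; b] = [set i; j] -> (a = i /\ b = j) \/ (a = j /\ b = i).
Proof.
move=> /setP E; have := E a; rewrite !inE eqxx => /esym/orP[]/eqP ai.
  left; split=> //; have := E j; rewrite ai !inE eqxx orbT => /orP[]/eqP //.
  move=> ji; have := E b; rewrite !inE eqxx orbT ji => /esym/orP[]/eqP ->; exact/esym.
right; split=> //; have := E i; rewrite ai !inE eqxx => /orP[]/eqP //.
move=> ij; have := E b; rewrite !inE eqxx orbT ij => /esym/orP[]/eqP ->; exact/esym.
Qed.

Lemma mem_edges (N : nat) (W : graph N) i j :
  ([set i; j] \in edges W) = val W i j.
Proof.
apply/imsetP/idP => [[[a b]]|Wij]; last by exists (i, j); rewrite ?inE.
by rewrite inE /= => Wab /esym/set2_eqP[[<- <-]|[<- <-]] //; rewrite graph_sym.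
Qed.

Lemma edges_sub (N : nat) (W : graph N) : edges W \subset pairs setT.
Proof.
apply/subsetP=> e /imsetP[[a b]]; rewrite !inE /= => Wab ->.
rewrite subsetT cards2; have [ab|//] := eqVneq a b.
by rewrite ab graph_irr in Wab.
Qed.

Lemma sum_edges (V : nmodType) (N : nat) (F : {set {set 'I_N}} -> V) :
  \sum_(W : graph N) F (edges W) =
  \sum_(H : {set {set 'I_N}} | H \subset pairs setT) F H.
Proof.
pose M (H : {set {set 'I_N}}) : 'M[bool]_N :=
  \matrix_(i, j) ((i != j) && ([set i; j] \in H)).
have MP H : is_adjacency (M H).
  apply/andP; split; apply/forallP=> i; last by rewrite mxE eqxx.
  by apply/forallP=> j; rewrite !mxE (eq_sym j) (setUC [set j]).
rewrite (reindex_onto (@edges N) (fun H => exist _ (M H) (MP H) : graph N)).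
  apply: eq_bigl => W; rewrite edges_sub; apply/esym/eqP/val_inj/matrixP => i j /=.
  rewrite mxE mem_edges; have [->|//] := eqVneq i j; by rewrite graph_irr.
move=> H HT; apply/setP=> e; apply/imsetP/idP => [[[a b]]|eH].
  by rewrite inE /= mxE => /andP[_ ?] ->.
have /pairsP[i [j [_ _ ij ee]]] := subsetP HT _ eH.
by exists (i, j); rewrite ?inE //= mxE ij -ee.
Qed.

Lemma prod_pairs (R : comPzSemiRingType) (N : nat) (f : {set 'I_N} -> R) :
  \prod_(i < N) \prod_(j < N | (i < j)%N) f [set i; j] =
  \prod_(e in pairs [set: 'I_N]) f e.
Proof.
rewrite pair_big_dep /=.
have -> : pairs [set: 'I_N] =
    [set [set p.1; p.2] | p in [set p : 'I_N * 'I_N | (p.1 < p.2)%N]].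
  apply/setP=> e; apply/pairsP/imsetP => [[i [j [_ _ ij ->]]]|[[i j]]].
    have : (i < j)%N || (j < i)%N by rewrite -neq_ltn.
    by case/orP=> h; [exists (i, j)|exists (j, i)]; rewrite ?inE // setUC.
  rewrite inE /= => ij ->; exists i, j; rewrite !inE; split=> //.
  by apply: contraTneq ij => ->; rewrite ltnn.
rewrite big_imset /=; first by apply: eq_bigl => p; rewrite inE.
move=> [i j] [i' j']; rewrite !inE /= => ij ij' /set2_eqP[[-> ->]//|[ii jj]].
by move: ij ij'; rewrite ii jj => /ltnW; rewrite leqNgt => /negPf->.
Qed.

Definition edge_pmf (R : pzRingType) (N : nat) (w : {set 'I_N} -> R)
    (H : {set {set 'I_N}}) : R :=
  \prod_(e in pairs [set: 'I_N]) (if e \in H then w e else 1 - w e).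

Lemma graph_pmfE (R : realType) (N : nat) (q : 'I_N -> 'I_N -> R)
    (w : {set 'I_N} -> R) (W : graph N) :
  (forall i j, q i j = w [set i; j]) -> graph_pmf q W = edge_pmf w (edges W).
Proof.
move=> qw; rewrite /edge_pmf -prod_pairs; apply: eq_bigr => i _.
by apply: eq_bigr => j _; rewrite mem_edges qw.
Qed.

(* With x the ratio of the average of the mu i to f0, this integrates
   a * x - a ^+ 2 / 4 * x ^+ 2 <= min 1 x. *)
Lemma bayes_risk_ge (R : realFieldType) (O I : finType) (P : pred I)
    (f0 : O -> R) (f mu : I -> O -> R) (phi : pred O) (c C a : R) :
  (0 < #|P|)%N -> (forall w, 0 < f0 w) ->
  (forall i w, P i -> 0 <= mu i w <= f i w) ->
  (forall i, P i -> c <= \sum_w mu i w) ->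
  \sum_(i | P i) \sum_(j | P j) \sum_w mu i w * mu j w / f0 w <=
    C * #|P|%:R ^+ 2 ->
  0 <= a <= 1 ->
  a * c - a ^+ 2 / 4 * C <=
  \sum_(w | phi w) f0 w +
  \big[Num.max/0]_(i | P i) \sum_(w | ~~ phi w) f i w.
Proof.
move=> P0 f00 mu0 hc hC /andP[a0 a1]; set M := \big[Num.max/0]_(i | P i) _.
have n0 : 0 < #|P|%:R :> R by rewrite ltr0n.
set m : R := #|P|%:R in n0 hC.
pose Q w := (\sum_(i | P i) mu i w) / m.
have Q0 w : 0 <= Q w.
  by rewrite divr_ge0 ?(ltW n0) // sumr_ge0 // => i /(mu0 i w)/andP[].
(* The worst-case error is at least the average error, hence at least the mass of the truncated
   mixture [Q]. *)
have QM : \sum_(w | ~~ phi w) Q w <= M.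
  rewrite -mulr_suml ler_pdivrMr // exchange_big /=.
  rewrite mulr_natr -sumr_const [leRHS]big_mkcond /= [leRHS](_ : _ = \sum_(i | P i) M); last first.
    by rewrite [RHS]big_mkcond; apply: eq_bigr.
  apply: ler_sum => i Pi; apply: (@le_trans _ _ (\sum_(w | ~~ phi w) f i w)).
    by apply: ler_sum => w _; case/andP: (mu0 i w Pi).
  exact: (@le_bigmax_cond _ _ _ 0 _ P (fun i => \sum_(w | ~~ phi w) f i w)).
apply: (@le_trans _ _ (\sum_w (a * Q w - a ^+ 2 / 4 * (Q w ^+ 2 / f0 w)))).
  rewrite sumrB -!mulr_sumr; apply: lerB; apply: ler_wpM2l => //.
  - rewrite -mulr_suml ler_pdivlMr // exchange_big /=.
    rewrite mulr_natr -sumr_const [leLHS]big_mkcond /= [leLHS](_ : _ = \sum_(i | P i) c); last first.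
      by rewrite [RHS]big_mkcond; apply: eq_bigr.
    exact: ler_sum.
  - by rewrite divr_ge0 ?exprn_ge0.
  rewrite (_ : \sum_w _ = (\sum_(i | P i) \sum_(j | P j) \sum_w mu i w * mu j w / f0 w) / m ^+ 2).
    by rewrite ler_pdivrMr // exprn_gt0.
  under [in RHS]eq_bigr do rewrite exchange_big /=.
  rewrite [in RHS]exchange_big /= mulr_suml; apply: eq_bigr => w _.
  rewrite /Q exprMn exprVn mulrAC; congr (_ / _).
  rewrite expr2 mulr_suml mulr_suml; apply: eq_bigr => i _.
  by rewrite mulr_sumr mulr_suml.
(* Where the test accepts, the integrand is at most [Q] since [a <= 1]; where it rejects, it is at
   most [f0] by completing a square. *)
rewrite [leLHS](bigID phi) /=; apply: lerD; last first.
  apply: le_trans QM; apply: ler_sum => w _.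
  rewrite lerBlDr; apply: (@le_trans _ _ (Q w)); first exact: ler_piMl.
  by rewrite lerDl mulr_ge0 ?divr_ge0 ?exprn_ge0 // ltW.
apply: ler_sum => w _; rewrite -subr_ge0.
rewrite (_ : _ - _ = (f0 w - a / 2 * Q w) ^+ 2 / f0 w).
  by rewrite divr_ge0 ?sqr_ge0 // ltW.
by field; rewrite gt_eqF.
Qed.

(** * The truncated planted likelihood *)

Definition planted (R : pzRingType) (N : nat) (p0 p1 : R) (S e : {set 'I_N}) : R :=
  if e \subset S then p1 else p0.

Lemma planted_set2 (R : pzRingType) (N : nat) (p0 p1 : R) (S : {set 'I_N}) i j :
  planted p0 p1 S [set i; j] = if (i \in S) && (j \in S) then p1 else p0.
Proof. by rewrite /planted subUset !sub1set. Qed.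

Lemma good_setI (T : finType) (k : nat) (S : {set T}) (H : {set {set T}}) :
  H \subset pairs setT -> good k S (H :&: pairs S) = good k S H.
Proof.
move=> HT; have E (B : {set T}) : B \subset S -> (H :&: pairs S) ::&: B = H ::&: B.
  move=> BS; apply/setP=> e; rewrite !inE.
  case eH: (e \in H) => //=; case eB: (e \subset B); rewrite ?andbF //.
  rewrite (subset_trans eB BS) /= andbT.
  by move: (subsetP HT _ eH); rewrite inE => /andP[].
by apply/goodP/goodP => g B BS B0; have := g B BS B0; rewrite E.
Qed.

(** Truncation only looks at pairs inside [S], where edges have probability [p1]; the remaining
    edges integrate to 1. This links the truncation event to the exploration. *)
Lemma planted_mass (R : realType) (N : nat) (p0 p1 : R) (S : {set 'I_N}) (k : nat) :
  \sum_(H : {set {set 'I_N}} | H \subset pairs setT)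
     edge_pmf (planted p0 p1 S) H * (good k S H)%:R =
  tight_mass p1 k k S set0.
Proof.
transitivity (\sum_(H : {set {set 'I_N}} | H \subset pairs setT)
   edge_pmf (planted p0 p1 S) H * (good k S (H :&: pairs S))%:R).
  by apply: eq_bigr => H HT; rewrite good_setI.
rewrite (sum_prod_marginal _ (fun e => 1 - _) (fun K => (good k S K)%:R)) ?pairs_sub ?subsetT //.
rewrite [X in _ * X]big1 => [|e _]; last by rewrite addrC subrK.
rewrite mulr1 /tight_mass big_mkcondr; apply: eq_bigr => K KS.
rewrite tight0 //; case: (good k S K); last by rewrite mulr0.
rewrite mulr1 bernE //; apply: eq_bigr => e; rewrite inE /planted => /andP[-> _].
by [].
Qed.

Lemma edge_pmf_gt0 (R : realType) (N : nat) (w : {set 'I_N} -> R) H :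
  (forall e, 0 < w e < 1) -> 0 < edge_pmf w H.
Proof.
move=> w01; apply: prodr_gt0 => e _; case/andP: (w01 e) => w0 w1.
by case: ifP => _ //; rewrite subr_gt0.
Qed.

Lemma edge_pmf_ge0 (R : realType) (N : nat) (w : {set 'I_N} -> R) H :
  (forall e, 0 <= w e <= 1) -> 0 <= edge_pmf w H.
Proof.
move=> w01; apply: prodr_ge0 => e _; case/andP: (w01 e) => w0 w1.
by case: ifP => _ //; rewrite subr_ge0.
Qed.

(** The ratio factors over edges. Outside [S :&: S'] the two weights of an edge sum to 1; inside, a
    present edge weighs [p1 ^+ 2 / p0] and an absent one at most 1. The truncation on [S] passes to
    subgraphs and the one on [S'] is bounded by 1. *)
Lemma second_moment_le (R : realType) (N : nat) (p0 p1 : R) (S S' : {set 'I_N})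
    (k : nat) :
  0 < p0 < 1 -> p0 <= p1 <= 1 ->
  \sum_(H : {set {set 'I_N}} | H \subset pairs setT)
     edge_pmf (planted p0 p1 S) H * (good k S H)%:R *
     (edge_pmf (planted p0 p1 S') H * (good k S' H)%:R) /
     edge_pmf (fun=> p0) H <=
  \sum_(K : {set {set 'I_N}} | (K \subset pairs (S :&: S')) && good k S K)
     (p1 ^+ 2 / p0) ^+ #|K|.
Proof.
move=> /andP[p00 p01] /andP[p10 p11].
have p1p : 0 < p1 by apply: lt_le_trans p10.
have q0 : 0 < 1 - p0 by rewrite subr_gt0.
pose a e := planted p0 p1 S e * planted p0 p1 S' e / p0.
pose b e := (1 - planted p0 p1 S e) * (1 - planted p0 p1 S' e) / (1 - p0).
have pl01 (A e : {set 'I_N}) : 0 <= planted p0 p1 A e <= 1.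
  by rewrite /planted; case: ifP => _; rewrite ?(ltW p1p) ?(ltW p00) ?p11 // ltW.
have a0 e : 0 <= a e.
  by rewrite /a divr_ge0 ?(ltW p00) // mulr_ge0 //; case/andP: (pl01 S e) (pl01 S' e) => ? _ /andP[].
have b0 e : 0 <= b e.
  rewrite /b divr_ge0 ?(ltW q0) // mulr_ge0 // subr_ge0.
    by case/andP: (pl01 S e).
  by case/andP: (pl01 S' e).
have f0 (A : {set 'I_N}) H : 0 < edge_pmf (fun=> p0) H :> R.
  by apply: edge_pmf_gt0 => e; rewrite p00 p01.
apply: (@le_trans _ _ (\sum_(H : {set {set 'I_N}} | H \subset pairs setT)
   (\prod_(e in pairs setT) (if e \in H then a e else b e)) *
   (good k S (H :&: pairs (S :&: S')))%:R)).
  apply: ler_sum => H HT.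
  rewrite mulrACA [leLHS]mulrAC.
  have -> : \prod_(e in pairs setT) (if e \in H then a e else b e) =
    edge_pmf (planted p0 p1 S) H * edge_pmf (planted p0 p1 S') H / edge_pmf (fun=> p0) H.
    rewrite /edge_pmf -big_split -prodf_div /=.
    by apply: eq_bigr => e _; case: ifP.
  rewrite ler_wpM2l //.
    by rewrite divr_ge0 ?mulr_ge0 ?edge_pmf_ge0 // => e; rewrite !ltW.
  case gS: (good k S H); last by rewrite mul0r.
  rewrite (goodS (subxx S) (subsetIl H _) gS).
  by case: (good k S' H); rewrite ?mulr0 ?mulr1.
rewrite (sum_prod_marginal _ _ (fun K => (good k S K)%:R)) ?pairs_sub ?subsetT //.
rewrite [X in _ * X]big1 => [|e]; last first.
  rewrite /a /b /planted !inE subsetI => /andP[+ /andP[_ e2]]; rewrite e2 andbT.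
  by case: (e \subset S); case: (e \subset S') => //= _; field; rewrite !lt0r_neq0.
rewrite mulr1 [leRHS]big_mkcondr /=; apply: ler_sum => K KS.
case: (good k S K); last by rewrite mulr0.
rewrite mulr1; apply: (@le_trans _ _ (bern (p1 ^+ 2 / p0) 1 (pairs (S :&: S')) K)).
  rewrite bernE //; apply: ler_prod => e; rewrite inE subsetI => /andP[/andP[eS eS'] _].
  rewrite /a /b /planted eS eS'; case: ifP => _.
    by rewrite -expr2 lexx divr_ge0 ?exprn_ge0 // ltW.
  rewrite divr_ge0 ?(ltW q0) ?mulr_ge0 ?subr_ge0 //=.
  rewrite ler_pdivrMr // mul1r; apply: (@le_trans _ _ (1 - p1)).
    by rewrite ler_piMl ?subr_ge0 // gerBl ltW.
  by rewrite lerD2l lerN2.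
by rewrite /bern expr1n mulr1.
Qed.

(** After exchanging sums, a forest [K] on [S] is counted once for each [S'] containing [cover K], a
    fraction at most [(n / N) ^+ #|cover K|] of all choices. [forest_sum_le] then applies with
    [rho = n / N]. *)
Lemma sum_second_moment_le (R : realType) (N n : nat) (t r : R) (k : nat) :
  0 <= t -> 1 <= r -> (0 < k)%N -> (n <= N)%N ->
  t * (n%:R / N%:R) * expR 1 * n%:R <= r ->
  \sum_(S : {set 'I_N} | #|S| == n) \sum_(S' : {set 'I_N} | #|S'| == n)
  \sum_(K : {set {set 'I_N}} | (K \subset pairs (S :&: S')) && good k S K)
     t ^+ #|K| <=
  (1 + expR 1 * (n%:R / N%:R) * r ^+ k) ^+ n * ('C(N, n))%:R ^+ 2.
Proof.
move=> t0 r1 k0 nN tr; set rho : R := n%:R / N%:R.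
have rho0 : 0 <= rho by rewrite divr_ge0.
set B : R := ('C(N, n))%:R; set z := 1 + _.
apply: (@le_trans _ _ (\sum_(S : {set 'I_N} | #|S| == n) z ^+ n * B)); last first.
  rewrite (eq_bigl (fun S => S \in [pred S : {set 'I_N} | #|S| == n])) //.
  by rewrite sumr_const card_sets_of_size -mulr_natr -mulrA expr2.
apply: ler_sum => S /eqP Sn.
rewrite (exchange_big_dep (fun K : {set {set 'I_N}} => (K \subset pairs S) && good k S K)) /=; last first.
  move=> S' K _; rewrite pairsI subsetI => /andP[/andP[-> _] ->] //.
apply: (@le_trans _ _ (\sum_(K : {set {set 'I_N}} | (K \subset pairs S) && good k S K)
    (t ^+ #|K| * rho ^+ #|cover K|) * B)).
  apply: ler_sum => K /andP[KS gK]; rewrite -mulrA.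
  rewrite sumr_const -mulr_natr ler_wpM2l ?exprn_ge0 //.
  have := @card_supersets_le R 'I_N n (cover K); rewrite card_ord => /(_ nN).
  apply: le_trans; rewrite ler_nat; apply: subset_leq_card.
  apply/subsetP=> S'; rewrite !inE unfold_in => /andP[-> /andP[]].
  by rewrite pairsI subsetI => /andP[_ /cover_pairs ->].
rewrite -mulr_suml ler_wpM2r //.
have := @forest_sum_le R t rho r 'I_N k S t0 rho0 r1 k0.
by rewrite Sn => /(_ tr)[].
Qed.

(** * Asymptotics *)

From mathcomp Require Import all_classical all_reals all_analysis.
Import Order.TTheory GRing.Theory Num.Theory.
Local Open Scope classical_set_scope.
Local Open Scope ring_scope.

Lemma risk_ge (R : realType) (N n k : nat) (p0 p1 c C a : R) (phi : test N) :
  0 < p0 < 1 -> p0 <= p1 <= 1 -> (n <= N)%N ->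
  (forall S : {set 'I_N}, #|S| = n -> c <= tight_mass p1 k k S finset.set0) ->
  \sum_(S : {set 'I_N} | #|S| == n) \sum_(S' : {set 'I_N} | #|S'| == n)
  \sum_(K : {set {set 'I_N}} |
         (K \subset pairs (S :&: S')%SET) && good k S K) (p1 ^+ 2 / p0) ^+ #|K|
    <= C * ('C(N, n))%:R ^+ 2 ->
  0 <= a <= 1 ->
  a * c - a ^+ 2 / 4 * C <= risk n p0 p1 phi.
Proof.
move=> hp0 hp1 nN hc hC ha.
have pl01 (A e : {set 'I_N}) : 0 <= planted p0 p1 A e <= 1.
  case/andP: hp0 hp1 => p00 p01 /andP[p10 p11].
  rewrite /planted; case: ifP => _; first by rewrite p11 (le_trans _ p10) // ltW.
  by rewrite !ltW.
pose mu (S : {set 'I_N}) (W : graph N) :=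
  edge_pmf (planted p0 p1 S) (edges W) * (good k S (edges W))%:R.
have := @bayes_risk_ge R _ _ [pred S : {set 'I_N} | #|S| == n]
  (fun W : graph N => edge_pmf (fun=> p0) (edges W))
  (fun S W => edge_pmf (planted p0 p1 S) (edges W)) mu phi c C a.
move=> /(_ _ _ _ _ _ ha)/le_trans; apply.
- by rewrite card_sets_of_size bin_gt0.
- by move=> W; apply: edge_pmf_gt0.
- move=> S W _; rewrite /mu; case: (good k S _).
    by rewrite mulr1 lexx edge_pmf_ge0.
  by rewrite mulr0 lexx edge_pmf_ge0.
- move=> S /eqP /hc/le_trans; apply; rewrite -(planted_mass p0).
  by rewrite -(sum_edges (fun H => edge_pmf (planted p0 p1 S) H * (good k S H)%:R)).
- rewrite card_sets_of_size; apply: le_trans hC; apply: ler_sum => S _; apply: ler_sum => S' _.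
  rewrite (sum_edges (fun H => edge_pmf (planted p0 p1 S) H * (good k S H)%:R *
     (edge_pmf (planted p0 p1 S') H * (good k S' H)%:R) / edge_pmf (fun=> p0) H)).
  exact: second_moment_le.
rewrite /risk le_eqVlt; apply/orP; left; apply/eqP; congr (_ + _).
  apply: eq_bigr => W _; rewrite (@graph_pmfE _ _ _ (fun=> p0)) //.
apply: eq_bigr => S _; apply: eq_bigr => W _; rewrite (@graph_pmfE _ _ _ (planted p0 p1 S)) //.
by move=> i j; rewrite planted_set2.
Qed.

Lemma minimax_risk_ge (R : realType) (N n : nat) (p0 p1 x : R) :
  (forall phi : test N, x <= risk n p0 p1 phi) -> x <= minimax_risk N n p0 p1.
Proof.
move=> h; apply: lb_le_inf; first by exists (risk n p0 p1 ((fun=> true) : test N)); exists (fun=> true).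
by move=> _ [phi _ <-].
Qed.

Lemma limn_einf_gt0 (R : realType) (u : nat -> R) (x : R) :
  0 < x -> (\forall N \near \oo, x <= u N) ->
  (0 < limn_einf (fun N => (u N)%:E))%E.
Proof.
move=> x0 [m _ hm]; apply: (@lt_le_trans _ _ x%:E); first by rewrite lte_fin.
rewrite limn_einf_lim (cvg_lim _ (@cvg_einfs_sup _ _)) //.
apply: (@le_trans _ _ (einfs (fun N => (u N)%:E) m)); last by apply: ereal_sup_ubound; exists m.
by apply: le_ereal_inf_tmp => _ [N /= mN <-]; rewrite lee_fin hm.
Qed.

Lemma expR_ln_small (R : realType) (d eps : R) : 0 < d -> 0 < eps ->
  \forall N \near \oo, expR (- (d * ln N%:R)) <= eps.
Proof.
move=> d0 e0; near=> N.
have hN : expR (- ln eps / d) <= N%:R by near: N; exact: nbhs_infty_ger.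
have N0 : 0 < N%:R :> R by apply: lt_le_trans hN; exact: expR_gt0.
rewrite -[leRHS]lnK ?posrE // ler_expR lerNl.
rewrite mulrC -ler_pdivrMr // -[leLHS]expRK ler_ln ?posrE ?expR_gt0 //.
Unshelve. all: by end_near. Qed.

(** This is [1 + x < expR x] at [x = lam - 1]; equivalently, [rate lam] is positive. *)
Lemma lam_exp_lt1 (R : realType) (lam : R) : 0 < lam < 1 ->
  lam * expR (1 - lam) < 1.
Proof.
move=> /andP[l0 l1]; have := @expR_gt1Dx R (lam - 1).
rewrite subr_eq0 lt_eqF // => /(_ isT); rewrite addrC subrK => h.
apply: (@lt_le_trans _ _ (expR (lam - 1) * expR (1 - lam))).
  by rewrite ltr_pM2r ?expR_gt0.
by rewrite -expRD addrA subrK subrr expR0.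
Qed.

Lemma beta_exists (R : realType) (lam : R) : 0 < lam < 1 ->
  exists2 beta : R, 0 <= beta & forall u : nat, u%:R / (1 - lam) <=
     beta * (1 - lam * expR (1 - lam)) * lam^-1 ^+ u.
Proof.
move=> hl; have ls := lam_exp_lt1 hl; case/andP: hl => l0 l1.
have d0 : 0 < 1 - lam * expR (1 - lam) by rewrite subr_gt0.
have g0 : 0 < ln lam^-1 by rewrite ln_gt0 // invf_gt1.
have b0 : 0 < 1 - lam by rewrite subr_gt0.
(* The witness comes from [u * ln lam^-1 <= lam^-1 ^+ u], the other factors being made to cancel. *)
exists ((1 - lam)^-1 / ln lam^-1 / (1 - lam * expR (1 - lam))).
  by rewrite !divr_ge0 ?invr_ge0 ?ltW.
move=> u; rewrite divfK ?gt_eqF // mulrC -mulrA ler_pM2l ?invr_gt0 //.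
rewrite mulrC ler_pdivlMr //; apply: (@le_trans _ _ (1 + u%:R * ln lam^-1)); first by rewrite lerDr.
by apply: le_trans (expR_ge1Dx _) _; rewrite expRM_natl lnK // posrE invr_gt0.
Qed.

(* Trees are truncated at size c * ln N: the first bound on c makes larger trees
   unlikely, the second keeps the second moment bounded. *)
Lemma tree_size_rate_exists (R : realType) (kappa lambda0 lambda1 : R) :
  0 < kappa -> kappa < 1 / 2 -> 0 < lambda0 -> 0 < lambda1 < 1 ->
  lambda1 ^+ 2 * expR 1 <= lambda0 \/
  (lambda0 < lambda1 ^+ 2 * expR 1 /\
   1 < (1 - 2 * kappa) / kappa *
       (rate lambda1 / ln (expR 1 * lambda1 ^+ 2 / lambda0))) ->
  exists2 c : R, 0 < c & kappa < rate lambda1 * c /\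
    c * ln (Num.max 1 (expR 1 * lambda1 ^+ 2 / lambda0)) < 1 - 2 * kappa.
Proof.
move=> k0 k2 l00 hl.
have I0 : 0 < rate lambda1.
  have := lam_exp_lt1 hl; case/andP: hl => l0 l1; rewrite -[X in X * _](@lnK _ lambda1) ?posrE //.
  rewrite -expRD -[ltRHS]expR0 ltr_expR /rate; lra.
have k12 : 0 < 1 - 2 * kappa by lra.
case=> [le0|[lt0 hr]].
  (* Here the maximum is 1 and its logarithm vanishes, so any [c] above [kappa / rate lambda1]
     works. *)
  exists (kappa / rate lambda1 + 1); first by rewrite addr_gt0 ?divr_gt0.
  split; first by rewrite mulrDr mulrC divfK ?gt_eqF // mulr1 ltrDl.
  rewrite max_l; first by rewrite ln1 mulr0.
  by rewrite ler_pdivrMr // mul1r mulrC.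
have th1 : 1 < expR 1 * lambda1 ^+ 2 / lambda0.
  by rewrite ltr_pdivlMr // mul1r mulrC.
rewrite max_r ?(ltW th1) //; set L := ln _ in hr *.
have L0 : 0 < L by rewrite ln_gt0.
have h : kappa / rate lambda1 < (1 - 2 * kappa) / L.
  rewrite ltr_pdivrMr // mulrAC ltr_pdivlMr //.
  move: hr; rewrite mulf_div ltr_pdivlMr ?mulr_gt0 // mul1r; lra.
(* The midpoint of the interval of admissible [c], nonempty by the hypothesis of the second
   situation. *)
exists ((kappa / rate lambda1 + (1 - 2 * kappa) / L) / 2).
  by rewrite divr_gt0 // addr_gt0 ?divr_gt0.
move: h; set x := kappa / _; set y := _ / L => h.
have xI : rate lambda1 * x = kappa by rewrite mulrC divfK ?gt_eqF.
have yL : y * L = 1 - 2 * kappa by rewrite divfK ?gt_eqF.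
split; first by rewrite -[ltLHS]xI ltr_pM2l //; lra.
by rewrite -yL ltr_pM2r //; lra.
Qed.

Lemma good_mass_ge (R : realType) (lam p beta c : R) (T : finType) (k : nat)
    (S : {set T}) :
  0 < lam < 1 -> 0 <= p <= lam -> (0 < k)%N -> 0 <= beta ->
  (forall u : nat, u%:R / (1 - lam) <=
     beta * (1 - lam * expR (1 - lam)) * lam^-1 ^+ u) ->
  #|S|%:R * p = lam ->
  (lam * expR (1 - lam)) ^+ k * lam^-1 * #|S|%:R <= c ->
  expR (- (beta * (lam * expR (1 - lam) + lam))) - c <=
  tight_mass p k k S finset.set0.
Proof.
move=> hl hp k0 b0 hb Sp pen.
have pS : p * #|S|%:R <= lam by rewrite mulrC Sp.
apply: le_trans (@tight_mass_ge R lam p beta T k hl hp k0 b0 hb S finset.set0 k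
  (leqnn k) (finset.sub0set S) pS).
rewrite eqxx mul0r subr0 finset.cards0 expr0; apply: lerB => //.
rewrite ler_expR lerN2 (_ : p * beta * _ = beta * (#|S|%:R * p * expR (1 - lam) + p)); last by ring.
by rewrite Sp ler_wpM2l // lerD2l; case/andP: hp.
Qed.

(** The bound for one fixed [N]. The three smallness conditions on powers of [N] give, in order,
    [n <= N], a negligible penalty for large trees, and a second moment of at most [expR 1]. *)
Lemma minimax_risk_ge_large (R : realType) (kappa lambda0 lambda1 cc beta c : R)
    (N n : nat) (p0 p1 : R) :
  0 < kappa -> 0 < lambda0 -> 0 < lambda1 < 1 -> 0 < cc -> 0 <= beta ->
  (forall u : nat, u%:R / (1 - lambda1) <=
     beta * (1 - lambda1 * expR (1 - lambda1)) * lambda1^-1 ^+ u) ->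
  let r := Num.max 1 (expR 1 * lambda1 ^+ 2 / lambda0) in
  `|n%:R - N%:R `^ kappa| < 1 ->
  0 <= p0 < p1 /\ p1 <= 1 ->
  N%:R * p0 = lambda0 -> n%:R * p1 = lambda1 ->
  0 < c <= 1 -> expR (- (beta * (lambda1 * expR (1 - lambda1) + lambda1))) = 2 * c ->
  (0 < N)%N ->
  expR (- ((1 - kappa) * ln N%:R)) <= 1 / 2 ->
  expR (- ((rate lambda1 * cc - kappa) * ln N%:R)) <= c * lambda1 / 2 ->
  expR (- ((1 - 2 * kappa - cc * ln r) * ln N%:R)) <= (4 * expR 1 * r)^-1 ->
  3 / 4 * (c ^+ 2 / expR 1) <= minimax_risk N n p0 p1.
Proof.
move=> ka0 l00 hl cc0 b0 hb r hn [/andP[p00' p01] p11] N0E l1E /andP[c0 c1] cE N0 E1 E2 E3.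
case/andP: (hl) => l0 l1.
have e0 : 0 < expR 1 :> R := expR_gt0 _.
have e1 : 1 <= expR 1 :> R by rewrite -[leLHS]expR0 ler_expR.
have Npos : 0 < N%:R :> R by rewrite ltr0n.
set L := ln N%:R in E1 E2 E3.
have L0 : 0 <= L by rewrite ln_ge0 // ler1n.
have NE : N%:R = expR L by rewrite lnK // posrE.
have r1 : 1 <= r by rewrite le_max lexx.
have r0 : 0 < r by apply: lt_le_trans r1.
have lr0 : 0 <= ln r by rewrite ln_ge0.
have n0 : (0 < n)%N by rewrite lt0n; apply: contraTneq l0 => n0; rewrite -l1E n0 mul0r ltxx.
have npos : 0 < n%:R :> R by rewrite ltr0n.
have p0pos : 0 < p0.
  by rewrite -(pmulr_rgt0 _ Npos) N0E.
have nle : n%:R <= 2 * expR (kappa * L).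
  have : 1 <= expR (kappa * L) by rewrite -[leLHS]expR0 ler_expR mulr_ge0 // ltW.
  move: hn; rewrite /powR gt_eqF // -/L ltr_norml => /andP[_]; lra.
have nN : (n <= N)%N.
  rewrite -(ler_nat R); apply: le_trans nle _.
  have -> : N%:R = expR ((1 - kappa) * L) * expR (kappa * L) :> R.
    by rewrite NE -expRD; congr expR; ring.
  rewrite ler_wpM2r ?expR_ge0 //.
  have := ler_wpM2r (expR_ge0 ((1 - kappa) * L)) E1.
  rewrite expRN mulVf ?gt_eqF ?expR_gt0 //; lra.
set k := (Num.truncn (cc * L)).+1.
have ccL0 : 0 <= cc * L by rewrite mulr_ge0 // ltW.
have /andP[kle klt] : (k%:R <= cc * L + 1) && (cc * L < k%:R).
  have /andP[h1 h2] := Num.Theory.truncn_itv ccL0.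
  by rewrite h2 andbT -natr1 lerD2r.
have lsE : lambda1 * expR (1 - lambda1) = expR (- rate lambda1).
  rewrite -{1}[lambda1]lnK ?posrE // -expRD; congr expR; rewrite /rate; ring.
have I0 : 0 < rate lambda1.
  by have := lam_exp_lt1 hl; rewrite lsE -expR0 ltr_expR oppr_lt0.
(* With [n <= 2 * N ^ kappa], the penalty is at most [2 / lambda1] times [N] to the power
   [kappa - rate lambda1 * cc]. *)
have pen : (lambda1 * expR (1 - lambda1)) ^+ k * lambda1^-1 * n%:R <= c.
  apply: (@le_trans _ _ (expR (- (rate lambda1 * (cc * L))) * lambda1^-1 *
      (2 * expR (kappa * L)))).
    apply: ler_pM => //; first by rewrite mulr_ge0 ?invr_ge0 ?(ltW l0) // lsE exprn_ge0 ?expR_ge0.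
    rewrite ler_wpM2r ?invr_ge0 ?(ltW l0) // lsE -expRM_natl ler_expR mulrN lerN2.
    by rewrite [leRHS]mulrC ler_wpM2l ?(ltW I0) // ltW.
  rewrite (_ : _ * _ = 2 / lambda1 * expR (- ((rate lambda1 * cc - kappa) * L))); last first.
    rewrite (_ : - ((_ - _) * L) = - (rate lambda1 * (cc * L)) + kappa * L); last by ring.
    by rewrite expRD; ring.
  rewrite mulrC -ler_pdivlMr ?divr_gt0 // invf_div mulrA //.
have p1l : p1 <= lambda1.
  by rewrite -l1E ler_peMl ?ler1n // (le_trans _ (ltW p01)) // ltW.
have mass (S : {set 'I_N}) : #|S| = n -> c <= tight_mass p1 k k S finset.set0.
  move=> Sn; have := @good_mass_ge R lambda1 p1 beta c _ k S hl _ _ b0 hb.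
  rewrite Sn cE (_ : 2 * c - c = c); last by ring.
  apply=> //; by rewrite p1l (le_trans p00') // ltW.
have rkE : r ^+ k <= r * expR (cc * L * ln r).
  rewrite -{1 2}[r]lnK ?posrE // -expRM_natl -expRD ler_expR.
  rewrite -[X in X + _]mul1r -mulrDl ler_wpM2r // addrC //.
(* By [1 + x <= expR x] it suffices that [n * x <= 1], where [n * x] is at most [4 * expR 1 * r]
   times [N] to the power [2 * kappa + cc * ln r - 1]. *)
have C1 : (1 + expR 1 * (n%:R / N%:R) * r ^+ k) ^+ n <= expR 1.
  apply: (@le_trans _ _ (expR (expR 1 * (n%:R / N%:R) * r ^+ k) ^+ n)).
    rewrite lerXn2r ?nnegrE ?expR_ge0 ?expR_ge1Dx //.
    by rewrite addr_ge0 ?mulr_ge0 ?exprn_ge0 ?divr_ge0 // ltW.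
  rewrite -expRM_natl ler_expR.
  apply: (@le_trans _ _ (expR 1 / N%:R * ((2 * expR (kappa * L)) ^+ 2 * (r * expR (cc * L * ln r))))).
    rewrite (_ : n%:R * _ = expR 1 / N%:R * (n%:R ^+ 2 * r ^+ k)); last first.
      by rewrite expr2; move: (r ^+ k) (n%:R : R) (N%:R : R) => *; ring.
    rewrite ler_wpM2l ?divr_ge0 ?(ltW e0) // ler_pM ?exprn_ge0 ?(ltW r0) //.
    by rewrite lerXn2r ?nnegrE ?(le_trans _ nle).
  rewrite NE -expRN.
  rewrite (_ : _ * _ = 4 * expR 1 * r * expR (- ((1 - 2 * kappa - cc * ln r) * L))).
    rewrite mulrC -ler_pdivlMr ?mul1r // !mulr_gt0 //.
  rewrite (_ : - ((_ - _ ) * L) = - L + (kappa * L + kappa * L) + cc * L * ln r); last by ring.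
  by rewrite !expRD; ring.
apply: minimax_risk_ge => phi.
(* The choice [a = c / expR 1] with [C = expR 1] turns [a * c - a ^+ 2 / 4 * C] into the claimed
   constant. *)
have ha : 0 <= c / expR 1 <= 1.
  by rewrite divr_ge0 ?(ltW c0) ?(ltW e0) //= ler_pdivrMr // mul1r (le_trans c1).
have := @risk_ge R N n k p0 p1 c (expR 1) (c / expR 1) phi.
rewrite (_ : _ - _ = 3 / 4 * (c ^+ 2 / expR 1)); last by field; rewrite gt_eqF.
apply => //.
- by rewrite p0pos (lt_le_trans p01).
- by rewrite p11 ltW.
apply: le_trans (@sum_second_moment_le R N n (p1 ^+ 2 / p0) r k _ r1 (ltn0Sn _) nN _) _.
- by rewrite divr_ge0 ?exprn_ge0 // ltW // (lt_trans p0pos).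
(* Substituting [N * p0 = lambda0] and [n * p1 = lambda1] makes the left side equal to
   [expR 1 * lambda1 ^+ 2 / lambda0]. *)
- rewrite /r le_max; apply/orP; right.
  rewrite le_eqVlt; apply/orP; left; apply/eqP.
  rewrite -N0E -l1E; field; rewrite !gt_eqF //.
by rewrite ler_wpM2r ?exprn_ge0.
Qed.


Theorem theorem5 (R : realType) (kappa lambda0 lambda1 : R)
    (n : nat -> nat) (p0 p1 : nat -> R)
    (kappa_gt0 : 0 < kappa) (kappa_lt : kappa < 1 / 2)
    (lambda0_gt0 : 0 < lambda0) (lambda1_gt0 : 0 < lambda1)
    (* n = N ^ kappa up to rounding (floor, ceiling, nearest integer) *)
    (n_kappa : forall N : nat, `|(n N)%:R - N%:R `^ kappa| < 1)
    (p01 : \forall N \near \oo, 0 <= p0 N < p1 N /\ p1 N <= 1)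
    (lambda0E : \forall N \near \oo, N%:R * p0 N = lambda0)
    (lambda1E : \forall N \near \oo, (n N)%:R * p1 N = lambda1)
    (situation :
      (lambda1 < 1 /\ lambda1 ^+ 2 * expR 1 <= lambda0) \/
      [/\ lambda1 < 1,
          lambda0 < lambda1 ^+ 2 * expR 1 &
          1 < (1 - 2 * kappa) / kappa *
              (rate lambda1 / ln (expR 1 * lambda1 ^+ 2 / lambda0))]) :
  no_test_asymptotically_powerful n p0 p1.

Proof.
set r := Num.max 1 (expR 1 * lambda1 ^+ 2 / lambda0).
have hl : 0 < lambda1 < 1 by rewrite lambda1_gt0; case: situation => -[].
have hsit : lambda1 ^+ 2 * expR 1 <= lambda0 \/
    (lambda0 < lambda1 ^+ 2 * expR 1 /\
     1 < (1 - 2 * kappa) / kappa *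
         (rate lambda1 / ln (expR 1 * lambda1 ^+ 2 / lambda0))).
  by case: situation => -[]; [left|right].
have [cc cc0 [hcc1 hcc2]] :=
  tree_size_rate_exists kappa_gt0 kappa_lt lambda0_gt0 hl hsit.
have [beta b0 hb] := beta_exists hl.
(* Half of the probability of a forest survives; the other half is the allowance for trees of more
   than [k] vertices. *)
set c := expR (- (beta * (lambda1 * expR (1 - lambda1) + lambda1))) / 2.
have c0 : 0 < c by rewrite divr_gt0 ?expR_gt0.
have c1 : c <= 1.
  rewrite ler_pdivrMr // mul1r (@le_trans _ _ 1) ?ler1n // -[leRHS]expR0 ler_expR.
  by rewrite oppr_le0 mulr_ge0 // addr_ge0 ?mulr_ge0 ?expR_ge0 // ltW.
have r0 : 0 < r by rewrite lt_max ltr01.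
apply: (@limn_einf_gt0 _ _ (3 / 4 * (c ^+ 2 / expR 1))).
  by rewrite mulr_gt0 ?divr_gt0 ?exprn_gt0 ?expR_gt0.
near=> N.
apply: (@minimax_risk_ge_large R kappa lambda0 lambda1 cc beta c) => //.
- by near: N.
- by near: N.
- by near: N.
- by rewrite c0.
- by rewrite [RHS]mulrC divfK.
- by near: N; exact: nbhs_infty_ge.
- by near: N; apply: expR_ln_small => //; lra.
- near: N; apply: expR_ln_small; first by rewrite subr_gt0.
  by rewrite divr_gt0 ?(mulr_gt0 c0).
- near: N; apply: expR_ln_small; first by rewrite subr_gt0.
  by rewrite invr_gt0 !mulr_gt0 ?expR_gt0.
Unshelve. all: by end_near. Qed.
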